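(* Let $H$ be a finite-dimensional coquasitriangular Hopf algebra, and let $\mathcal Q:H\to H^*$ be its quantum Killing form, $\mathcal Q(h)(g)=\mathcal R(g_{(1)}\otimes h_{(1)})\mathcal R(h_{(2)}\otimes g_{(2)})$. Then there is a morphism of Hopf algebroids $\underline H\#H^{op}\to H^*\#H^{op}$ to the Weyl Hopf algebroid, induced by $\mathcal Q:\underline H\to H^*$ on the base algebra (i.e. given by $\mathcal Q\otimes\mathrm{id}$ on the total algebras). This is an isomorphism if $H$ is factorisable.
   Context: Everything is over a field $k$. A coquasitriangular Hopf algebra is a Hopf algebra $H$ with a convolution-invertible linear map $\mathcal R:H\otimes H\to k$ such that $\mathcal R(h\otimes gf)=\mathcal R(h_{(1)}\otimes f)\mathcal R(h_{(2)}\otimes g)$, $\mathcal R(hg\otimes f)=\mathcal R(h\otimes f_{(1)})\mathcal R(g\otimes f_{(2)})$ and $g_{(1)}h_{(1)}\mathcal R(h_{(2)}\otimes g_{(2)})=\mathcal R(h_{(1)}\otimes g_{(1)})h_{(2)}g_{(2)}$. A finite-dimensional such $H$ is factorisable if $\mathcal Q$ is a linear isomorphism. A right Drinfeld–Yetter module over $H$ is a vector space $B$ with a right action $\triangleleft$ and a right coaction $b\mapsto b_{(0)}\otimes b_{(1)}$ of $H$ such that $(b\triangleleft h_{(2)})_{(0)}\otimes h_{(1)}(b\triangleleft h_{(2)})_{(1)}=b_{(0)}\triangleleft h_{(1)}\otimes b_{(1)}h_{(2)}$. A braided-commutative algebra in this category is such a $B$ that is a right $H$-module algebra and right $H$-comodule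 algebra with $ab=b_{(0)}(a\triangleleft b_{(1)})$. For such $B$, the action Hopf algebroid $B\#H^{op}$ is the left bialgebroid over $B$ on $B\otimes H$ with product $(a\#h)(b\#g)=a(b\triangleleft h_{(1)})\#gh_{(2)}$, source $s(a)=a\#1$, target $t(a)=a_{(0)}\#a_{(1)}$, coproduct $\Delta(a\#h)=(a\#h_{(1)})\otimes_B(1\#h_{(2)})$ and counit $\varepsilon(a\#h)=a\varepsilon(h)$. $\underline H$ is the vector space $H$ with product $h\bullet g=h_{(2)}g_{(3)}\mathcal R(h_{(3)}\otimes Sg_{(1)})\mathcal R(h_{(1)}\otimes g_{(2)})$, coaction $\mathrm{Ad}_R(h)=h_{(2)}\otimes(Sh_{(1)})h_{(3)}$ and action $h\triangleleft g=h_{(2)}\mathcal R(g_{(1)}\otimes h_{(1)})\mathcal R(h_{(3)}\otimes g_{(2)})$; it is a braided-commutative algebra in the category. $H^*$ (dual Hopf algebra, $\langle ab,h\rangle=\langle a,h_{(1)}\rangle\langle b,h_{(2)}\rangle$, $\langle a,hg\rangle=\langle a_{(1)},h\rangle\langle a_{(2)},g\rangle$) is a braided-commutative algebra in the category with $a\triangleleft h=\langle a_{(1)},h\rangle a_{(2)}$ and coaction determined by $(\mathrm{id}\otimes b)(\Delta_Ra)=b_{(1)}a\,S(b_{(2)})$; $H^*\#H^{op}$ is called the Weyl Hopf algebroid. A morphism between a left $B$-bialgebroid $(\mathcal L,s,t,\Delta,\varepsilon)$ and a left $B'$-bialgebroid $(\mathcal L',s',t',\Delta',\varepsilon')$ is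 a pair of algebra maps $\Phi:\mathcal L\to\mathcal L'$, $\varphi:B\to B'$ with $\Phi\circ s=s'\circ\varphi$, $\Phi\circ t=t'\circ\varphi$, $(\Phi\otimes\Phi)\circ\Delta=\Delta'\circ\Phi$ (in $\mathcal L'\otimes_{B'}\mathcal L'$), $\varepsilon'\circ\Phi=\varphi\circ\varepsilon$; it is an isomorphism if both maps are invertible. *)

(* Defs.v *)
From HB Require Import structures.
From mathcomp Require Import all_boot all_order all_algebra all_field.
From mathcomp Require Import sesquilinear.

Set Implicit Arguments.
Unset Strict Implicit.
Unset Printing Implicit Defensive.

Import GRing.Theory.
Local Open Scope ring_scope.

Reserved Notation "x ⊗ y" (at level 35, right associativity).
Reserved Notation "\tsum_ ( a , b <- x ) F"
  (at level 41, F at level 41, a name, b name, x at level 99,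
   format "'[' \tsum_ ( a ,  b  <-  x ) '/  '  F ']'").
Reserved Notation "\sw_ ( a , b <- h ) F"
  (at level 41, F at level 41, a name, b name, h at level 99,
   format "'[' \sw_ ( a ,  b  <-  h ) '/  '  F ']'").
Reserved Notation "\sw_ ( a , b , c <- h ) F"
  (at level 41, F at level 41, a name, b name, c name, h at level 99,
   format "'[' \sw_ ( a ,  b ,  c  <-  h ) '/  '  F ']'").

(* Tensor products of finite-dimensional vector spaces.  An element of U ⊗ V  *)
(* is given by its matrix of coordinates on the products of basis vectors.    *)
(* [tsum x F], written \tsum_(u, v <- x) F u v, is the value at x of the      *)
(* linear map U ⊗ V -> W induced by a bilinear map F: see [tsum_linear],      *)
(* [tsumE] and [tsum_tens] below, which are the universal property.           *)
Section Tensor.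
Variable k : fieldType.

Definition tensor (U V : vectType k) : vectType k :=
  'M[k]_(\dim {: U}, \dim {: V}).

Definition tens (U V : vectType k) (u : U) (v : V) : tensor U V :=
  \matrix_(i, j) (coord (vbasis {: U}) i u * coord (vbasis {: V}) j v).

Definition tsum (U V W : vectType k) (x : tensor U V) (F : U -> V -> W) : W :=
  \sum_i \sum_j
    (x : 'M[k]_(_, _)) i j *: F (vbasis {: U})`_i (vbasis {: V})`_j.

End Tensor.

Notation "x ⊗ y" := (tens x y) : ring_scope.
Notation "\tsum_ ( a , b <- x ) F" := (tsum x (fun a b => F)) : ring_scope.

Section TensorTheory.
Variable k : fieldType.
Implicit Types U V W : vectType k.

Lemma tsum_linear U V W (F : U -> V -> W) : linear (fun x => tsum x F).
Proof.
move=> c x y; rewrite /tsum scaler_sumr -big_split; apply: eq_bigr => i _ /=.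
rewrite scaler_sumr -big_split; apply: eq_bigr => j _ /=.
by rewrite !mxE scalerDl scalerA.
Qed.

Lemma tens_linearl U V (v : V) : linear (fun u : U => u ⊗ v).
Proof.
by move=> c u u'; apply/matrixP => i j; rewrite !mxE linearP mulrDl mulrA.
Qed.

Lemma tens_linearr U V (u : U) : linear (fun v : V => u ⊗ v).
Proof.
by move=> c v v'; apply/matrixP => i j; rewrite !mxE linearP mulrDr mulrCA.
Qed.

Lemma tsumE U V W (F : U -> V -> W) u v :
    (forall b, linear (F^~ b)) -> (forall a, linear (F a)) ->
  \tsum_(a, b <- u ⊗ v) F a b = F u v.
Proof.
move=> l1 l2.
pose F1 b : {linear U -> W} :=
  HB.pack (F^~ b) (GRing.isLinear.Build _ _ _ _ (F^~ b) (l1 b)).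
pose F2 a : {linear V -> W} :=
  HB.pack (F a) (GRing.isLinear.Build _ _ _ _ (F a) (l2 a)).
transitivity (F1 v u); last by [].
rewrite [u in RHS](coord_vbasis (memvf u)) linear_sum.
apply: eq_bigr => i _; rewrite linearZ -[F1 _ _]/(F2 (vbasis {: U})`_i v) /=.
rewrite [v in RHS](coord_vbasis (memvf v)).
transitivity (coord (vbasis {: U}) i u *: F2 (vbasis {: U})`_i
  (\sum_j coord (vbasis {: V}) j v *: (vbasis {: V})`_j)); last by [].
rewrite linear_sum scaler_sumr.
by apply: eq_bigr => j _; rewrite linearZ scalerA mxE.
Qed.

Lemma tsum_tens U V (x : tensor U V) : \tsum_(a, b <- x) a ⊗ b = x.
Proof.
rewrite [RHS]matrix_sum_delta; apply: eq_bigr => i _; apply: eq_bigr => j _.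
congr (_ *: _); apply/matrixP => i' j'; rewrite !mxE.
rewrite !coord_free ?(basis_free (vbasisP _)) -?natrM ?mulnb //.
by rewrite (eq_sym i) (eq_sym j).
Qed.

Lemma tsum_sum U V W (F : U -> V -> W) I (r : seq I) P (x : I -> tensor U V) :
  tsum (\sum_(i <- r | P i) x i) F = \sum_(i <- r | P i) tsum (x i) F.
Proof.
apply: (big_morph (fun x => tsum x F)) => [y z|].
  by have := tsum_linear F 1 y z; rewrite !scale1r.
by have := tsum_linear F (-1) 0 0; rewrite !scaleN1r oppr0 addr0 addNr.
Qed.

Lemma tsumZ U V W (F : U -> V -> W) c (x : tensor U V) :
  tsum (c *: x) F = c *: tsum x F.
Proof.
have t0 : tsum 0 F = 0.
  by have := tsum_linear F (-1) 0 0; rewrite !scaleN1r oppr0 addr0 addNr.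
by have := tsum_linear F c x 0; rewrite /= t0 !addr0.
Qed.

Definition tmap U V U' V' (f : U -> U') (g : V -> V') (x : tensor U V) :
    tensor U' V' :=
  \tsum_(u, v <- x) f u ⊗ g v.

End TensorTheory.

Record hopfAlgebra (k : fieldType) := HopfAlgebra {
  hopf_sort :> falgType k;
  comul : {linear hopf_sort -> tensor hopf_sort hopf_sort};
  counit : {scalar hopf_sort};
  antipode : {linear hopf_sort -> hopf_sort};
  comulA : forall h : hopf_sort,
    \tsum_(h1, h2 <- comul h) \tsum_(h11, h12 <- comul h1) h11 ⊗ h12 ⊗ h2 =
    \tsum_(h1, h2 <- comul h) \tsum_(h21, h22 <- comul h2) h1 ⊗ h21 ⊗ h22;
  counitl : forall h : hopf_sort, \tsum_(h1, h2 <- comul h) counit h1 *: h2 = h;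
  counitr : forall h : hopf_sort, \tsum_(h1, h2 <- comul h) counit h2 *: h1 = h;
  comul1 : comul 1 = 1 ⊗ 1;
  comulM : forall h g : hopf_sort, comul (h * g) =
    \tsum_(h1, h2 <- comul h) \tsum_(g1, g2 <- comul g) (h1 * g1) ⊗ (h2 * g2);
  counit1 : counit 1 = 1;
  counitM : forall h g : hopf_sort, counit (h * g) = counit h * counit g;
  antipodel : forall h : hopf_sort,
    \tsum_(h1, h2 <- comul h) antipode h1 * h2 = counit h *: 1;
  antipoder : forall h : hopf_sort,
    \tsum_(h1, h2 <- comul h) h1 * antipode h2 = counit h *: 1
}.
Arguments comul {k h0} : rename.
Arguments counit {k h0} : rename.
Arguments antipode {k h0} : rename.

(* Sweedler notation: \sw_(h1, h2 <- h) F is F evaluated at                   *)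
(* h_(1) ⊗ h_(2), and \sw_(h1, h2, h3 <- h) F at h_(1) ⊗ h_(2) ⊗ h_(3).       *)
Section Sweedler.
Variables (k : fieldType) (H : hopfAlgebra k) (W : vectType k).

Definition sweedler2 (h : H) (F : H -> H -> W) : W := tsum (comul h) F.

Definition sweedler3 (h : H) (F : H -> H -> H -> W) : W :=
  sweedler2 h (fun h1 h' => sweedler2 h' (F h1)).

End Sweedler.

Notation "\sw_ ( a , b <- h ) F" := (sweedler2 h (fun a b => F)) : ring_scope.
Notation "\sw_ ( a , b , c <- h ) F" :=
  (sweedler3 h (fun a b c => F)) : ring_scope.

(* A linear map H ⊗ H -> k is given as a bilinear form.  Scalar-valued sums   *)
(* are taken in k^o, i.e. k as a vector space over itself.                    *)
Section Coquasitriangular.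
Variables (k : fieldType) (H : hopfAlgebra k).

Definition convolution_inverse (R R' : {biscalar H}) : Prop :=
  forall h g : H,
    \sw_(h1, h2 <- h) \sw_(g1, g2 <- g) (R h1 g1 * R' h2 g2 : k^o) =
      counit h * counit g
    /\
    \sw_(h1, h2 <- h) \sw_(g1, g2 <- g) (R' h1 g1 * R h2 g2 : k^o) =
      counit h * counit g.

Record coquasitriangular := Coquasitriangular {
  rform :> {biscalar H};
  rform_inv : exists R' : {biscalar H}, convolution_inverse rform R';
  rform_mulr : forall h g f : H,
    rform h (g * f) = \sw_(h1, h2 <- h) (rform h1 f * rform h2 g : k^o);
  rform_mull : forall h g f : H,
    rform (h * g) f = \sw_(f1, f2 <- f) (rform h f1 * rform g f2 : k^o);
  rform_comm : forall h g : H,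
    \sw_(h1, h2 <- h) \sw_(g1, g2 <- g) rform h2 g2 *: (g1 * h1) =
    \sw_(h1, h2 <- h) \sw_(g1, g2 <- g) rform h1 g1 *: (h2 * g2)
}.

End Coquasitriangular.

(* The algebras and bialgebroids constructed below live on spaces which are   *)
(* not instances of [falgType], so structure maps and axioms are separated.   *)
Section Algebra.
Variable k : fieldType.

Record algebraData := AlgebraData {
  alg_space :> vectType k;
  alg_one : alg_space;
  alg_mul : alg_space -> alg_space -> alg_space
}.

Record is_algebra (A : algebraData) : Prop := IsAlgebra {
  alg_mul_linearl : forall b : A, linear (fun a => alg_mul a b);
  alg_mul_linearr : forall a : A, linear (fun b => alg_mul a b);
  alg_mulA : associative (@alg_mul A);
  alg_mul1l : left_id (alg_one A) (@alg_mul A);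
  alg_mul1r : right_id (alg_one A) (@alg_mul A)
}.

Record algebra_map (A A' : algebraData) (f : A -> A') : Prop := AlgebraMap {
  algebra_map_linear : linear f;
  algebra_map1 : f (alg_one A) = alg_one A';
  algebra_mapM : forall a b, f (alg_mul a b) = alg_mul (f a) (f b)
}.

Record algebra_antimap (A A' : algebraData) (f : A -> A') : Prop :=
  AlgebraAntimap {
  algebra_antimap_linear : linear f;
  algebra_antimap1 : f (alg_one A) = alg_one A';
  algebra_antimapM : forall a b, f (alg_mul a b) = alg_mul (f b) (f a)
}.

End Algebra.
Arguments alg_one {k}.
Infix "⋅" := alg_mul (at level 40, left associativity) : ring_scope.

Section Bialgebroid.
Variable k : fieldType.

(* The coproduct of a left B-bialgebroid L is valued in the quotient L ⊗_B L  *)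
(* of L ⊗ L; [bcomul] gives representatives in L ⊗ L.                         *)
Record bialgebroidData := BialgebroidData {
  bbase : algebraData k;
  btotal : algebraData k;
  bsource : bbase -> btotal;
  btarget : bbase -> btotal;
  bcomul : btotal -> tensor btotal btotal;
  bcounit : btotal -> bbase
}.

(* Equality in L ⊗_B L and in L ⊗_B L ⊗_B L, for the bimodule structure       *)
(* b.X.c = s(b) t(c) X on L: these are the quotients by the spans of the      *)
(* elements X.b ⊗ Y - X ⊗ b.Y, resp. of X.b ⊗ Y ⊗ Z - X ⊗ b.Y ⊗ Z and         *)
(* X ⊗ Y.b ⊗ Z - X ⊗ Y ⊗ b.Z.                                                 *)
Definition eq_over_base (L : bialgebroidData)
    (x y : tensor (btotal L) (btotal L)) : Prop :=
  exists r : seq (bbase L * btotal L * btotal L),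
    x - y = \sum_(p <- r) let: (b, X, Y) := p in
      ((btarget b ⋅ X) ⊗ Y - X ⊗ (bsource b ⋅ Y)).

Definition eq_over_base3 (L : bialgebroidData)
    (x y : tensor (btotal L) (tensor (btotal L) (btotal L))) : Prop :=
  exists r r' : seq (bbase L * btotal L * btotal L * btotal L),
    x - y =
      \sum_(p <- r) (let: (b, X, Y, Z) := p in
        (btarget b ⋅ X) ⊗ Y ⊗ Z - X ⊗ (bsource b ⋅ Y) ⊗ Z) +
      \sum_(p <- r') (let: (b, X, Y, Z) := p in
        X ⊗ (btarget b ⋅ Y) ⊗ Z - X ⊗ Y ⊗ (bsource b ⋅ Z)).

Record is_left_bialgebroid (L : bialgebroidData) : Prop := IsLeftBialgebroid {
  bbase_algebra : is_algebra (bbase L);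
  btotal_algebra : is_algebra (btotal L);
  bsource_map : algebra_map (@bsource L);
  btarget_map : algebra_antimap (@btarget L);
  bsource_target_comm : forall b c : bbase L,
    bsource b ⋅ btarget c = btarget c ⋅ bsource b;
  bcomul_linear : linear (@bcomul L);
  bcomul_source : forall (b : bbase L) X, eq_over_base
    (bcomul (bsource b ⋅ X)) (\tsum_(X1, X2 <- bcomul X) (bsource b ⋅ X1) ⊗ X2);
  bcomul_target : forall (b : bbase L) X, eq_over_base
    (bcomul (btarget b ⋅ X)) (\tsum_(X1, X2 <- bcomul X) X1 ⊗ (btarget b ⋅ X2));
  bcounit_linear : linear (@bcounit L);
  bcounit_source : forall (b : bbase L) X,
    bcounit (bsource b ⋅ X) = b ⋅ bcounit X;
  bcounit_target : forall (b : bbase L) X,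
    bcounit (btarget b ⋅ X) = bcounit X ⋅ b;
  bcomulA : forall X : btotal L, eq_over_base3
    (\tsum_(X1, X2 <- bcomul X) \tsum_(X11, X12 <- bcomul X1) X11 ⊗ X12 ⊗ X2)
    (\tsum_(X1, X2 <- bcomul X) X1 ⊗ bcomul X2);
  bcounitl : forall X : btotal L,
    \tsum_(X1, X2 <- bcomul X) bsource (bcounit X1) ⋅ X2 = X;
  bcounitr : forall X : btotal L,
    \tsum_(X1, X2 <- bcomul X) btarget (bcounit X2) ⋅ X1 = X;
  (* the image of the coproduct lies in the Takeuchi product, on which the    *)
  (* factorwise product is well defined                                       *)
  bcomul_takeuchi : forall (b : bbase L) X, eq_over_base
    (\tsum_(X1, X2 <- bcomul X) (X1 ⋅ btarget b) ⊗ X2)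
    (\tsum_(X1, X2 <- bcomul X) X1 ⊗ (X2 ⋅ bsource b));
  bcomul1 : eq_over_base (bcomul (alg_one (btotal L)))
    (alg_one (btotal L) ⊗ alg_one (btotal L));
  bcomulM : forall X Y : btotal L, eq_over_base (bcomul (X ⋅ Y))
    (\tsum_(X1, X2 <- bcomul X) \tsum_(Y1, Y2 <- bcomul Y)
      (X1 ⋅ Y1) ⊗ (X2 ⋅ Y2));
  bcounit1 : bcounit (alg_one (btotal L)) = alg_one (bbase L);
  bcounitM_source : forall X Y : btotal L,
    bcounit (X ⋅ Y) = bcounit (X ⋅ bsource (bcounit Y));
  bcounitM_target : forall X Y : btotal L,
    bcounit (X ⋅ Y) = bcounit (X ⋅ btarget (bcounit Y))
}.

Record bialgebroid_morphism (L L' : bialgebroidData)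
    (Phi : btotal L -> btotal L') (phi : bbase L -> bbase L') : Prop :=
  BialgebroidMorphism {
  morph_total : algebra_map Phi;
  morph_base : algebra_map phi;
  morph_source : forall b, Phi (bsource b) = bsource (phi b);
  morph_target : forall b, Phi (btarget b) = btarget (phi b);
  morph_comul : forall X,
    eq_over_base (tmap Phi Phi (bcomul X)) (bcomul (Phi X));
  morph_counit : forall X, bcounit (Phi X) = phi (bcounit X)
}.

Definition bialgebroid_isomorphism (L L' : bialgebroidData)
    (Phi : btotal L -> btotal L') (phi : bbase L -> bbase L') : Prop :=
  [/\ bialgebroid_morphism Phi phi, bijective Phi & bijective phi].

End Bialgebroid.

Section ActionAlgebroid.
Variables (k : fieldType) (H : hopfAlgebra k).

(* The structure maps of a right H-module and right H-comodule algebra.       *)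
Record moduleComoduleAlgebraData := ModuleComoduleAlgebraData {
  mca_alg :> algebraData k;
  mca_act : mca_alg -> H -> mca_alg;
  mca_coact : mca_alg -> tensor mca_alg H
}.

Variable B : moduleComoduleAlgebraData.

(* The algebra B # H^op. *)
Definition smash_opp : algebraData k :=
  @AlgebraData k (tensor B H) (alg_one B ⊗ 1) (fun x y : tensor B H =>
    \tsum_(a, h <- x) \tsum_(b, g <- y) \sw_(h1, h2 <- h)
      (a ⋅ mca_act b h1) ⊗ (g * h2)).

Definition action_algebroid : bialgebroidData k :=
  @BialgebroidData k B smash_opp
    (fun a => a ⊗ (1 : H))
    (fun a => mca_coact a)
    (fun x : tensor B H => \tsum_(a, h <- x) \sw_(h1, h2 <- h)
      (a ⊗ h1 : smash_opp) ⊗ (alg_one B ⊗ h2 : smash_opp))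
    (fun x : tensor B H => \tsum_(a, h <- x) counit h *: a).

End ActionAlgebroid.

(* The braided version of H obtained by transmutation, with its right         *)
(* H-action and right adjoint H-coaction.                                     *)
Section Transmutation.
Variables (k : fieldType) (H : hopfAlgebra k) (R : coquasitriangular H).

Definition transmuted_algebra : algebraData k :=
  @AlgebraData k H 1 (fun h g : H =>
    \sw_(h1, h2, h3 <- h) \sw_(g1, g2, g3 <- g)
      (R h3 (antipode g1) * R h1 g2) *: (h2 * g3)).

Definition transmuted : moduleComoduleAlgebraData H :=
  @ModuleComoduleAlgebraData k H transmuted_algebra
    (fun h g : H => \sw_(h1, h2, h3 <- h) \sw_(g1, g2 <- g)
      (R g1 h1 * R h3 g2) *: h2)
    (fun h : H => \sw_(h1, h2, h3 <- h) (h2 : H) ⊗ (antipode h1 * h3)).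

End Transmutation.

Section Dual.
Variables (k : fieldType) (H : hopfAlgebra k).

Definition dual : vectType k := 'Hom(H, k^o).

(* The linear form h |-> F h_(1) h_(2), for F bilinear.                       *)
Definition sweedler_form (F : H -> H -> k) : dual :=
  linfun (fun h => \sw_(h1, h2 <- h) (F h1 h2 : k^o)).

Lemma sweedler_formE (F : H -> H -> k) h :
  sweedler_form F h = \sw_(h1, h2 <- h) (F h1 h2 : k^o).
Proof.
have linF : linear (fun g => \sw_(g1, g2 <- g) (F g1 g2 : k^o)).
  by move=> c u v; rewrite /sweedler2 linearP tsum_linear.
pose G : {linear H -> k^o} := HB.pack (fun g => \sw_(g1, g2 <- g) (F g1 g2 : k^o))
  (GRing.isLinear.Build _ _ _ _ _ linF).
exact: (lfunE G).
Qed.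

Definition dual_basis (i : 'I_(\dim {: H})) : dual :=
  linfun (coord (vbasis {: H}) i : H -> k^o).

Lemma dual_basisE i h : dual_basis i h = coord (vbasis {: H}) i h.
Proof. exact: (lfunE (coord (vbasis {: H}) i : {linear H -> k^o})). Qed.

Definition dual_mul (a b : dual) : dual := sweedler_form (fun h1 h2 => a h1 * b h2).

Definition dual_one : dual := linfun (counit : H -> k^o).

Lemma dual_oneE h : dual_one h = counit h.
Proof. exact: (lfunE (counit : {linear H -> k^o})). Qed.

Definition dual_antipode (a : dual) : dual := (a \o linfun antipode)%VF.

Lemma dual_antipodeE (a : dual) h : dual_antipode a h = a (antipode h).
Proof. by rewrite comp_lfunE lfunE. Qed.

Definition dual_comul (a : dual) : tensor dual dual :=
  \sum_(i < \dim {: H}) \sum_(j < \dim {: H})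
    a ((vbasis {: H})`_i * (vbasis {: H})`_j) *:
      (dual_basis i ⊗ dual_basis j).

Lemma dual_comulE (a : dual) h g :
  \tsum_(a1, a2 <- dual_comul a) (a1 h * a2 g : k^o) = a (h * g).
Proof.
rewrite /dual_comul tsum_sum.
rewrite [h in RHS](coord_vbasis (memvf h)) mulr_suml linear_sum.
apply: eq_bigr => i _; rewrite tsum_sum.
rewrite [g in RHS](coord_vbasis (memvf g)) mulr_sumr linear_sum.
apply: eq_bigr => j _; rewrite tsumZ tsumE.
- rewrite !dual_basisE -scalerAl -scalerAr !linearZ /= /GRing.scale /=.
  by congr (_ * _); exact: mulrC.
- by move=> b c u v; rewrite add_lfunE scale_lfunE mulrDl -scalerAl.
- by move=> b c u v; rewrite add_lfunE scale_lfunE mulrDr -scalerAr.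
Qed.

Definition dual_act (a : dual) (h : H) : dual :=
  \tsum_(a1, a2 <- dual_comul a) a1 h *: a2.

(* b_(1) a S(b_(2)): the contraction of the H-coaction of a with b.           *)
Definition dual_coadjoint (a b : dual) : dual :=
  \tsum_(b1, b2 <- dual_comul b) dual_mul (dual_mul b1 a) (dual_antipode b2).

Definition dual_coact (a : dual) : tensor dual H :=
  \sum_(i < \dim {: H}) dual_coadjoint a (dual_basis i) ⊗ (vbasis {: H})`_i.

Lemma dual_coactE (a b : dual) :
  \tsum_(a0, a1 <- dual_coact a) b a1 *: a0 = dual_coadjoint a b.
Proof.
have lin_comul : linear dual_comul.
  move=> c u v; rewrite /dual_comul scaler_sumr -big_split.
  apply: eq_bigr => i _; rewrite scaler_sumr -big_split; apply: eq_bigr => j _.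
  by rewrite add_lfunE scale_lfunE /= scalerDl scalerA.
pose D : {linear dual -> tensor dual dual} :=
  HB.pack dual_comul (GRing.isLinear.Build _ _ _ _ dual_comul lin_comul).
have defb : b = \sum_(i < \dim {: H}) b (vbasis {: H})`_i *: dual_basis i.
  apply/lfunP => h; rewrite sum_lfunE [in LHS](coord_vbasis (memvf h)) linear_sum.
  apply: eq_bigr => i _; rewrite linearZ scale_lfunE dual_basisE /=.
  by rewrite /GRing.scale /= mulrC.
rewrite [RHS]/dual_coadjoint -[dual_comul b]/(D b) [in RHS]defb linear_sum !tsum_sum.
apply: eq_bigr => i _; rewrite linearZ tsumZ tsumE //.
- by move=> v c x y; rewrite scalerDr !scalerA mulrC.
- by move=> v c x y; rewrite linearP scalerDl scalerA.
Qed.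

Definition dual_algebra : algebraData k := AlgebraData dual_one dual_mul.

Definition dual_mca : moduleComoduleAlgebraData H :=
  @ModuleComoduleAlgebraData k H dual_algebra dual_act dual_coact.

(* H^* # H^op *)
Definition weyl_algebroid : bialgebroidData k := action_algebroid dual_mca.

End Dual.

Section Killing.
Variables (k : fieldType) (H : hopfAlgebra k) (R : coquasitriangular H).

Definition killing_form (h : H) : dual H :=
  sweedler_form (fun g1 g2 => \sw_(h1, h2 <- h) (R g1 h1 * R h2 g2 : k^o)).

Definition factorisable : Prop := bijective killing_form.

End Killing.

(* Main.v *)
From HB Require Import structures.
Require Import Defs.
From mathcomp Require Import all_boot all_order all_algebra all_field.
From mathcomp Require Import sesquilinear ring zify.

Set Implicit Arguments.
Unset Strict Implicit.
Unset Printing Implicit Defensive.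

Import GRing.Theory.
Local Open Scope ring_scope.

(** Why the proposition holds.  Both algebroids have the form B # H^op, and
    such a smash product is a left bialgebroid as soon as B is a
    braided-commutative algebra among the right Drinfeld-Yetter modules
    ([action_algebroid_left_bialgebroid]).  On elementary tensors each
    bialgebroid axiom becomes an axiom of B: braided commutativity makes the
    target map multiplicative and makes it commute with the source map, and the
    Drinfeld-Yetter condition is what puts the coproduct in the Takeuchi
    product.  An algebra map B -> B' that respects actions and coactions
    therefore extends, by the identity on H, to a morphism of bialgebroids,
    bijective when the map is ([action_algebroid_morphism],
    [action_algebroid_isomorphism]).  It remains to see that H^* and the
    transmutation of H are braided-commutative and that the quantum Killing
    form Q is such a map.

    For H^*, an element of H^* ⊗ H is the same as a linear map H -> H
    ([dual_eval_inj]), and the coaction of a becomes the map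
    x |-> a(x_(2)) x_(1) S(x_(3)).  In these terms every axiom follows by
    cancelling a pair S(x_(i)) x_(i+1) ([dual_braided_commutative]).

    For the transmutation, the axioms are identities between R-matrices.  They
    follow from the exchange relation of R, from the Yang-Baxter equation
    ([yang_baxter]), and from the versions of these two in which one argument
    is replaced by its antipode ([form_comm_antipode], [yang_baxter_antipode]):
    the product is defined with R(- ⊗ S -), which is inverse to R when the
    pieces of the second argument are taken in reverse order
    ([form_antipode_inv], [form_inv_antipode]).  Braided commutativity
    ab = b_(0) (a ◁ b_(1)) for the coaction b_(2) ⊗ S(b_(1)) b_(3) is
    equivalent to the reflection equation (a ◁ b_(1)) b_(2) = b_(1) (a ◁ b_(2))
    ([transmuted_reflection]).

    For Q, in matrix form Q is R_21 R_12; it is multiplicative by the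
    Yang-Baxter equation ([killing_formM]), it respects the actions because R
    is multiplicative in each argument, and it respects the coactions by two
    uses of the exchange relation ([killing_form_coact]).

    The computations are chains of explicit Sweedler sums, as on paper.  A
    nested sum is determined by the list of the positions at which pieces are
    successively split by the coproduct; coassociativity and the exchange of
    sums over different variables say that this list may be sorted
    ([splits_sort]).  The tactic [sw_auto] proves equalities of sums in this
    way, so that between two uses of it one only has to rewrite a group of
    consecutive pieces by an identity that holds for that group. *)

(** * Linear maps and tensor sums *)
Section LinearMaps.
Variable k : fieldType.
Implicit Types U V W X : vectType k.

(** The [linear_] lemmas below build up a linear map from its subterms; they
    are the clauses of the tactic [lin]. *)
Lemma linear_id U : linear (fun x : U => x).
Proof. by []. Qed.

Lemma linear_comp U V W (g : V -> W) (f : U -> V) :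
  linear g -> linear f -> linear (fun x => g (f x)).
Proof. by move=> lg lf c u v; rewrite lf lg. Qed.

Lemma linear_scalel U V (f : U -> k^o) (v : V) :
  linear f -> linear (fun x => (f x : k) *: v).
Proof. by move=> lf c x y; rewrite lf scalerDl scalerA. Qed.

Lemma linear_scaler U V (f : U -> V) (c : k) :
  linear f -> linear (fun x => c *: f x).
Proof. by move=> lf d x y; rewrite lf scalerDr !scalerA mulrC. Qed.

Lemma linear_mkl U (f : U -> k^o) (c : k) :
  linear f -> linear (fun x => ((f x : k) * c : k^o)).
Proof.
move=> lf d x y; have /= -> : f (d *: x + y) = d * f x + f y :> k := lf d x y.
by rewrite mulrDl -mulrA.
Qed.

Lemma linear_mkr U (f : U -> k^o) (c : k) :
  linear f -> linear (fun x => (c * (f x : k) : k^o)).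
Proof.
move=> lf d x y; have /= -> : f (d *: x + y) = d * f x + f y :> k := lf d x y.
by rewrite mulrDr mulrCA.
Qed.

Lemma linear_mull U (A : falgType k) (f : U -> A) (c : A) :
  linear f -> linear (fun x => f x * c).
Proof. by move=> lf d x y; rewrite lf mulrDl -scalerAl. Qed.

Lemma linear_mulr U (A : falgType k) (f : U -> A) (c : A) :
  linear f -> linear (fun x => c * f x).
Proof. by move=> lf d x y; rewrite lf mulrDr -scalerAr. Qed.

Lemma linear_tensl U V W (f : U -> V) (w : W) :
  linear f -> linear (fun x => f x ⊗ w).
Proof. by move=> lf d x y; rewrite lf tens_linearl. Qed.

Lemma linear_tensr U V W (f : U -> V) (w : W) :
  linear f -> linear (fun x => w ⊗ f x).
Proof. by move=> lf d x y; rewrite lf tens_linearr. Qed.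

Lemma linear_tsuml U V W X (f : X -> tensor U V) (F : U -> V -> W) :
  linear f -> linear (fun x => tsum (f x) F).
Proof. by move=> lf d x y; rewrite lf tsum_linear. Qed.

Lemma linear_tsumr U V W X (t : tensor U V) (F : X -> U -> V -> W) :
  (forall a b, linear (fun x => F x a b)) -> linear (fun x => tsum t (F x)).
Proof.
move=> lF d x y; rewrite /tsum scaler_sumr -big_split; apply: eq_bigr => i _ /=.
rewrite scaler_sumr -big_split; apply: eq_bigr => j _ /=.
by rewrite lF scalerDr !scalerA mulrC.
Qed.

Lemma tsum_lin U V W X (f : W -> X) (t : tensor U V) (F : U -> V -> W) :
  linear f -> f (tsum t F) = tsum t (fun a b => f (F a b)).
Proof.
move=> lf; pose g : {linear W -> X} :=
  HB.pack f (GRing.isLinear.Build _ _ _ _ f lf).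
rewrite -[f]/(g : W -> X) /tsum linear_sum; apply: eq_bigr => i _.
by rewrite linear_sum; apply: eq_bigr => j _; rewrite linearZ.
Qed.

Lemma eq_tsum U V W (t : tensor U V) (F G : U -> V -> W) :
  (forall a b, F a b = G a b) -> tsum t F = tsum t G.
Proof.
by move=> eqFG; apply: eq_bigr => i _; apply: eq_bigr => j _; rewrite eqFG.
Qed.

Lemma tsum_scale U V W (t : tensor U V) (F : U -> V -> W) c :
  \tsum_(a, b <- t) (c *: F a b) = c *: tsum t F.
Proof. by rewrite (@tsum_lin _ _ _ _ ( *:%R c)) //; exact/linear_scaler. Qed.

Lemma tsum_sumr U V W n (t : tensor U V) (F : 'I_n -> U -> V -> W) :
  \tsum_(a, b <- t) (\sum_i F i a b) = \sum_i tsum t (F i).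
Proof.
rewrite [RHS]exchange_big; apply: eq_bigr => i _ /=.
rewrite [RHS]exchange_big; apply: eq_bigr => j _ /=.
by rewrite scaler_sumr.
Qed.

Lemma tsum_exchange U V U' V' W (t : tensor U V) (t' : tensor U' V')
    (F : U -> V -> U' -> V' -> W) :
  \tsum_(a, b <- t) \tsum_(c, d <- t') F a b c d =
  \tsum_(c, d <- t') \tsum_(a, b <- t) F a b c d.
Proof.
rewrite [RHS]/tsum /= [LHS]/tsum.
under eq_bigr => i _ do under eq_bigr => j _ do rewrite -tsum_scale.
under eq_bigr => i _ do rewrite -tsum_sumr.
by rewrite -tsum_sumr.
Qed.

Lemma linear_scale U V (f : U -> V) :
  linear f -> forall c x, f (c *: x) = c *: f x.
Proof.
move=> lf; pose g : {linear U -> V} :=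
  HB.pack f (GRing.isLinear.Build _ _ _ _ f lf).
by move=> c x; rewrite -[f]/(g : U -> V) linearZ.
Qed.

Lemma tensor_ext U V W (f g : tensor U V -> W) :
    linear f -> linear g -> (forall a b, f (a ⊗ b) = g (a ⊗ b)) ->
  forall x, f x = g x.
Proof.
move=> lf lg eqfg x; rewrite -(tsum_tens x) (tsum_lin _ _ lf) (tsum_lin _ _ lg).
exact: eq_tsum.
Qed.

Lemma linear_sumE U V (f : U -> V) :
  linear f -> forall n (F : 'I_n -> U), f (\sum_i F i) = \sum_i f (F i).
Proof.
move=> lf n F; pose g : {linear U -> V} :=
  HB.pack f (GRing.isLinear.Build _ _ _ _ f lf).
by rewrite -[f]/(g : U -> V) linear_sum.
Qed.

Lemma tens_scalel U V c (u : U) (v : V) :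
  (c *: u) ⊗ v = c *: (u ⊗ v).
Proof. by apply/matrixP => i j; rewrite !mxE linearZ mulrA. Qed.

Lemma tens_scaler U V c (u : U) (v : V) :
  u ⊗ (c *: v) = c *: (u ⊗ v).
Proof. by apply/matrixP => i j; rewrite !mxE linearZ mulrCA. Qed.
End LinearMaps.

(** * Sweedler sums *)
Lemma eq_sw (k : fieldType) (H : hopfAlgebra k) (W : vectType k) (h : H)
    (F G : H -> H -> W) :
  (forall a b, F a b = G a b) -> sweedler2 h F = sweedler2 h G.
Proof. exact: eq_tsum. Qed.

Lemma sw_coassoc (k : fieldType) (H : hopfAlgebra k) (W : vectType k)
    (F : H -> H -> H -> W) (h : H) :
    (forall b c, linear (fun a => F a b c)) ->
    (forall a c, linear (fun b => F a b c)) ->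
    (forall a b, linear (F a b)) ->
  \sw_(x, c <- h) \sw_(a, b <- x) F a b c = \sw_(a, y <- h) \sw_(b, c <- y) F a b c.
Proof.
move=> l1 l2 l3.
pose ev (t : tensor H (tensor H H)) := \tsum_(a, y <- t) \tsum_(b, c <- y) F a b c.
have lev : linear ev by exact: tsum_linear.
have evE a b c : ev (a ⊗ b ⊗ c) = F a b c.
  rewrite /ev tsumE; first by rewrite tsumE.
  - by move=> y; apply: linear_tsumr => *; exact: l1.
  - by move=> x; exact: tsum_linear.
have := congr1 ev (comulA h); rewrite !(tsum_lin _ _ lev) => eq_ev.
transitivity (\tsum_(h1, h2 <- comul h)
   ev (\tsum_(h11, h12 <- comul h1) h11 ⊗ h12 ⊗ h2)).
  apply: eq_tsum => x c; rewrite (tsum_lin _ _ lev).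
  by apply: eq_tsum => a b; rewrite evE.
rewrite eq_ev; apply: eq_tsum => a y; rewrite (tsum_lin _ _ lev).
by apply: eq_tsum => b c; rewrite evE.
Qed.

Lemma sw_scale (k : fieldType) (H : hopfAlgebra k) (W : vectType k) (h : H)
    (F : H -> H -> W) c : \sw_(a, b <- h) (c *: F a b) = c *: sweedler2 h F.
Proof. exact: tsum_scale. Qed.

Lemma sw_lin (k : fieldType) (H : hopfAlgebra k) (W X : vectType k) (f : W -> X)
    (h : H) (F : H -> H -> W) :
  linear f -> f (sweedler2 h F) = \sw_(a, b <- h) f (F a b).
Proof. exact: tsum_lin. Qed.

Lemma sw_exchange (k : fieldType) (H : hopfAlgebra k) (W : vectType k) (h g : H)
    (F : H -> H -> H -> H -> W) :
  \sw_(a, b <- h) \sw_(c, d <- g) F a b c d =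
  \sw_(c, d <- g) \sw_(a, b <- h) F a b c d.
Proof. exact: tsum_exchange. Qed.

Lemma sw_tsum_exchange (k : fieldType) (H : hopfAlgebra k) (U V W : vectType k)
    (h : H) (t : tensor U V) (F : H -> H -> U -> V -> W) :
  \sw_(a, b <- h) \tsum_(c, d <- t) F a b c d =
  \tsum_(c, d <- t) \sw_(a, b <- h) F a b c d.
Proof. exact: tsum_exchange. Qed.

(** * Normal form of nested Sweedler sums *)
Section Normalisation.
Variables (k : fieldType) (H : hopfAlgebra k) (W : vectType k).
Implicit Types (s : seq H) (F : seq H -> W) (i j m : nat) (l : seq nat).

Lemma linear_swl (U : vectType k) (f : U -> H) (F : H -> H -> W) :
  linear f -> linear (fun x => sweedler2 (f x) F).
Proof.
by move=> lf; apply: linear_tsuml; apply: linear_comp lf => c u v; exact: linearP.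
Qed.

Lemma linear_swr (U : vectType k) h (F : U -> H -> H -> W) :
  (forall a b, linear (fun x => F x a b)) -> linear (fun x => sweedler2 h (F x)).
Proof. exact: linear_tsumr. Qed.

(** A sequence s lists the pieces h_(1), h_(2), ... of all the variables, in
    order.  Splitting the i-th piece by the coproduct inserts its two halves in
    its place, so a nested Sweedler sum is a composite of such splittings
    applied to the sequence of its variables. *)
Definition split i F s : W :=
  \sw_(a, b <- s`_i) F (take i s ++ [:: a, b & drop i.+1 s]).

Definition multilinear m F : Prop :=
  forall s s', size s + (size s').+1 = m -> linear (fun x => F (s ++ x :: s')).

Lemma split_cat F s x s' :
  split (size s) F (s ++ x :: s') = \sw_(a, b <- x) F (s ++ [:: a, b & s']).
Proof.
rewrite /split nth_cat ltnn subnn take_size_cat // -cat_rcons drop_size_cat //.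
by rewrite size_rcons.
Qed.

Lemma split_at s i : (i < size s)%N ->
  exists s1 x s2, s = s1 ++ x :: s2 /\ size s1 = i.
Proof.
move=> lti; exists (take i s), s`_i, (drop i.+1 s).
by rewrite -drop_nth // cat_take_drop size_takel // ltnW.
Qed.

Lemma multilinear_split m i F :
  (i < m)%N -> multilinear m.+1 F -> multilinear m (split i F).
Proof.
move=> ltim lF s s' szm; have [lti|lti|eqi] := ltngtP i (size s).
- have [s1 [y [s2 [eqs <-]]]] := split_at lti; rewrite {}eqs in szm *.
  move=> c u v /=; rewrite -!catA /= !split_cat; move: c u v.
  apply: linear_swr => a b c u v; have := lF (s1 ++ [:: a, b & s2]) s' _ c u v.
  by rewrite -!catA /=; apply; move: szm; rewrite !size_cat /=; lia.
- have /split_at[s1 [y [s2 [eqs szs]]]] : (i - (size s).+1 < size s')%N.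
    by rewrite -szm in ltim; lia.
  rewrite {}eqs in szm *.
  have splitE x : split i F (s ++ x :: s1 ++ y :: s2) =
      \sw_(a, b <- y) F (s ++ x :: s1 ++ [:: a, b & s2]).
    have -> : i = size (s ++ x :: s1) by rewrite size_cat /= szs; lia.
    rewrite -[x :: s1 ++ _]cat_cons catA split_cat.
    by apply: eq_sw => a b; rewrite -catA.
  move=> c u v /=; rewrite !splitE; move: c u v.
  apply: linear_swr => a b; apply: lF.
  by move: szm; rewrite !size_cat /=; lia.
- rewrite {}eqi => c u v /=; rewrite !split_cat; move: c u v.
  exact: linear_swl (@linear_id _ _).
Qed.


(** For j = i this is coassociativity; for j < i two different pieces are split,
    and the second of them has moved one place to the right. *)
Lemma split_split m i j F s : (j <= i < m)%N -> size s = m ->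
  multilinear m.+2 F -> split i (split j F) s = split j (split i.+1 F) s.
Proof.
case/andP=> + ltim szs lF; rewrite leq_eqVlt => /predU1P[->|ltji].
  have [|s1 [x [s2 [eqs szi]]]] := @split_at s i; first by rewrite szs.
  rewrite -szi eqs !split_cat.
  under eq_sw => a b do rewrite split_cat.
  rewrite [LHS]sw_coassoc.
  - apply: eq_sw => a y; rewrite -cat_rcons.
    rewrite -[(size s1).+1](size_rcons s1 a) split_cat.
    by apply: eq_sw => b c; rewrite cat_rcons.
  - move=> b c; apply: lF; move: szs; rewrite eqs size_cat /=; lia.
  - move=> a c u b b'; have := lF (rcons s1 a) (c :: s2) _ u b b'.
    by rewrite !cat_rcons; apply; move: szs; rewrite eqs size_cat size_rcons /=; lia.
  - move=> a b u c c'; have := lF (rcons (rcons s1 a) b) s2 _ u c c'.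
    by rewrite !cat_rcons; apply; move: szs; rewrite eqs size_cat !size_rcons /=; lia.
have [|s1 [x [s' [eqs szj]]]] := @split_at s j; first by rewrite szs; lia.
have [|s2 [y [s3 [eqs' szi]]]] := @split_at s' (i - j.+1).
  by move: szs; rewrite eqs size_cat /=; lia.
rewrite {}eqs {}eqs' {szs}; transitivity
  (\sw_(c, d <- y) \sw_(a, b <- x) F (s1 ++ [:: a, b & s2 ++ [:: c, d & s3]])).
  rewrite -[x :: _]cat_cons catA.
  have -> : i = size (s1 ++ x :: s2) by rewrite size_cat /=; lia.
  rewrite split_cat; apply: eq_sw => c d.
  by rewrite -catA /= -szj split_cat.
rewrite [LHS]tsum_exchange -szj split_cat; apply: eq_sw => a b.
have -> : i.+1 = size (s1 ++ [:: a, b & s2]) by rewrite size_cat /=; lia.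
rewrite -[[:: a, b & s2 ++ _]]/([:: a, b & s2] ++ _) catA split_cat.
by apply: eq_sw => c d; rewrite -catA.
Qed.

Definition splits l F : seq H -> W := foldr split F l.

(** The positions are taken in the growing sequence, which starts with m
    pieces. *)
Fixpoint valid m l : bool :=
  if l is i :: l' then (i < m)%N && valid m.+1 l' else true.

(** Insertion by means of [split_split], which turns the positions i, j with
    j <= i into j, i + 1: the result is increasing. *)
Fixpoint insert_split i l : seq nat :=
  if l is j :: l' then
    if (j <= i)%N then j :: insert_split i.+1 l' else i :: l
  else [:: i].

Definition sort_splits l : seq nat := foldr insert_split [::] l.

Lemma multilinear_splits m l F :
  valid m l -> multilinear (size l + m) F -> multilinear m (splits l F).
Proof.
elim: l m => //= i l IHl m /andP[ltim vl] lF.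
by apply: multilinear_split => //; apply: IHl; rewrite // addnS.
Qed.

Lemma size_insert_split i l : size (insert_split i l) = (size l).+1.
Proof. by elim: l i => //= j l IHl i; case: ifP => //= _; rewrite IHl. Qed.

Lemma valid_insert_split m i l : valid m (i :: l) -> valid m (insert_split i l).
Proof.
elim: l m i => [|j l IHl] m i //= /and3P[ltim ltjm vl].
case: leqP => [leji|_] /=; last by rewrite ltim ltjm vl.
by rewrite (leq_ltn_trans leji ltim) IHl //= ltnS ltim.
Qed.

Lemma valid_sort_splits m l : valid m l -> valid m (sort_splits l).
Proof.
elim: l m => //= i l IHl m /andP[ltim vl].
by apply: valid_insert_split; rewrite /= ltim IHl.
Qed.

Lemma size_sort_splits l : size (sort_splits l) = size l.
Proof. by elim: l => //= j l IHl; rewrite size_insert_split IHl. Qed.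

Lemma splits_insert m i l F s :
    valid m (i :: l) -> size s = m -> multilinear ((size l).+1 + m) F ->
  split i (splits l F) s = splits (insert_split i l) F s.
Proof.
elim: l m i s => [|j l IHl] m i s //= /and3P[ltim ltjm vl] szs lF.
case: leqP => //= leji.
have ltj : (j < m)%N by apply: leq_ltn_trans ltim.
rewrite (@split_split m i j (splits l F) s) ?leji //; last first.
  by apply: multilinear_splits; rewrite // !addnS in lF *.
apply: eq_sw => a b; apply: (IHl m.+1).
- by rewrite /= ltnS ltim.
- by rewrite size_cat /= size_drop size_takel; lia.
- by rewrite addnS.
Qed.

(** Increasing lists of positions record only how many pieces each variable is
    split into, so this is the normal form of a nested sum. *)
Lemma splits_sort m l F s :
    valid m l -> size s = m -> multilinear (size l + m) F ->
  splits l F s = splits (sort_splits l) F s.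
Proof.
elim: l m s => [//|i l IHl] m s /= /andP[ltim vl] szs lF.
rewrite -(@splits_insert m) ?size_sort_splits //; last first.
  by rewrite /= ltim valid_sort_splits.
apply: eq_sw => a b; apply: (IHl m.+1) => //; last by rewrite addnS.
by rewrite size_cat /= size_drop size_takel; lia.
Qed.

(** The summands are reified as curried functions of their pieces: unification
    finds such a function from a sum by abstracting the bound variables. *)
Fixpoint nfun n : Type := if n is m.+1 then H -> nfun m else W.

Fixpoint napply n : nfun n -> seq H -> W :=
  if n is m.+1 return nfun n -> seq H -> W then
    fun f s => napply (f (head 0 s)) (behead s)
  else fun w _ => w.

Fixpoint nlinear_head n : (H -> nfun n) -> Prop :=
  if n is m.+1 return (H -> nfun n) -> Prop then
    fun f => forall y, nlinear_head (fun x => f x y)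
  else fun f => linear f.

Fixpoint nlinear n : nfun n -> Prop :=
  if n is m.+1 return nfun n -> Prop then
    fun f => nlinear_head f /\ forall x, nlinear (f x)
  else fun _ => True.

Fixpoint nfun_eq n : nfun n -> nfun n -> Prop :=
  if n is m.+1 return nfun n -> nfun n -> Prop then
    fun f g => forall x, nfun_eq (f x) (g x)
  else fun v w => v = w.

Lemma nfun_eq_apply n (f g : nfun n) s : nfun_eq f g -> napply f s = napply g s.
Proof. by elim: n f g s => //= n IHn f g s eqfg; apply: IHn. Qed.

Lemma nlinear_apply n (f : nfun n) : nlinear f -> multilinear n (napply f).
Proof.
elim: n f => [|n IHn] f /=; first by move=> _ s s' szs; exfalso; move: szs; clear; lia.
move=> [lhead ltail] [|y s] s' /= szs; last by apply: IHn => //; lia.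
move=> {szs IHn ltail}; elim: n f lhead s' => [|n IHn] f lf s' //=.
exact: (IHn (fun x => f x (head 0 s'))).
Qed.

(** The value w is the sum of the values of f over the pieces that are obtained
    from s by splitting at the positions in l. *)
Definition represents l s (w : W) n (f : nfun n) : Prop :=
  w = splits l (napply f) s.

Lemma represents_sw l s i x (K : H -> H -> W) n (f : nfun n) :
    s`_i = x ->
    (forall a b,
      represents l (take i s ++ [:: a, b & drop i.+1 s]) (K a b) f) ->
  represents (i :: l) s (sweedler2 x K) f.
Proof. by move=> <- repK; apply: eq_sw => a b; rewrite repK. Qed.

Lemma represents_lin (U : vectType k) l s h (K : H -> H -> U) (g : U -> W)
    n (f : nfun n) : linear g ->
    represents l s (\sw_(a, b <- h) g (K a b)) f ->
  represents l s (g (sweedler2 h K)) f.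
Proof. by move=> lg; rewrite /represents /sweedler2 (tsum_lin _ _ lg). Qed.

Lemma represents_trans l s w w' n (f : nfun n) :
  w = w' -> represents l s w' f -> represents l s w f.
Proof. by move=> ->. Qed.

(** Two sums agree when they split each variable into the same number of pieces
    and have the same summand. *)
Lemma represents_eq s n l l' (f f' : nfun n) w w' :
    represents l s w f -> represents l' s w' f' ->
    [&& valid (size s) l, valid (size s) l', (size l + size s == n)%N &
        (size l' + size s == n)%N && (sort_splits l == sort_splits l')] ->
    nlinear f -> nfun_eq f f' ->
  w = w'.
Proof.
move=> -> -> /and5P[v v' /eqP szl /eqP szl' /eqP eql] lf eqf.
have mf := nlinear_apply lf.
have eqs t : splits l' (napply f') t = splits l' (napply f) t.
  elim: (l') t => [t|i r IHr t] /=; first by rewrite (nfun_eq_apply _ eqf).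
  by apply: eq_sw => a b; rewrite IHr.
rewrite eqs (@splits_sort (size s) l) ?szl //.
by rewrite (@splits_sort (size s) l') ?szl' // eql.
Qed.
End Normalisation.

(** * Tactics for linearity and for Sweedler sums *)
Section LinearForms.
Variables (k : fieldType) (H : hopfAlgebra k) (U : vectType k).

Lemma linear_forml (R : {biscalar H}) (f : U -> H) (y : H) :
  linear f -> linear (fun x => R (f x) y : k^o).
Proof. by move=> lf c u v; rewrite lf; exact: (linearPl R). Qed.

Lemma linear_formr (R : {biscalar H}) (f : U -> H) (y : H) :
  linear f -> linear (fun x => R y (f x) : k^o).
Proof. by move=> lf c u v; rewrite lf; exact: (linearPr R). Qed.

Lemma linear_antipode (f : U -> H) :
  linear f -> linear (fun x => antipode (f x)).
Proof. by move=> lf c u v; rewrite lf linearP. Qed.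

Lemma linear_comul (f : U -> H) : linear f -> linear (fun x => comul (f x)).
Proof. by move=> lf c u v; rewrite lf linearP. Qed.

Lemma linear_counit (f : U -> H) :
  linear f -> linear (fun x => counit (f x) : k^o).
Proof. by move=> lf c u v; rewrite lf linearP. Qed.

Lemma linear_dualr (a : dual H) (f : U -> H) :
  linear f -> linear (fun x => a (f x)).
Proof. by move=> lf c u v; rewrite lf linearP. Qed.

Lemma linear_duall (f : U -> dual H) (x : H) :
  linear f -> linear (fun a => f a x).
Proof. by move=> lf c u v; rewrite lf add_lfunE scale_lfunE. Qed.
End LinearForms.

(** Extension point of [lin] for the structure maps of particular algebras. *)
Ltac lin_hook := fail.

(** Proves that a function is linear, by descending to the occurrences of its
    argument. *)
Ltac lin :=
  cbv beta;
  lazymatch goal with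
  | |- forall _, _ => intro; lin
  | |- GRing.linear_for _ (fun x => x) => exact: linear_id
  | _ => first
    [ assumption
    | match goal with L : _ |- _ => apply: L end
    | apply: linear_scalel; lin | apply: linear_scaler; lin
    | apply: linear_tensl; lin | apply: linear_tensr; lin
    | apply: linear_forml; lin | apply: linear_formr; lin
    | apply: linear_antipode; lin
    | apply: linear_mkl; lin | apply: linear_mkr; lin
    | apply: linear_mull; lin | apply: linear_mulr; lin
    | apply: linear_counit; lin
    | lin_hook
    | apply: linear_swl; lin | apply: linear_swr; lin
    | apply: linear_tsuml; lin | apply: linear_tsumr; lin
    | apply: linear_comul; lin
    | apply: linear_duall; lin | apply: linear_dualr; lin
    ]
  end.

Lemma sw_mul (k : fieldType) (H : hopfAlgebra k) (W : vectType k) (h g : H)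
    (F : H -> H -> W) :
    (forall b, linear (F^~ b)) -> (forall a, linear (F a)) ->
  sweedler2 (h * g) F = \sw_(h1, h2 <- h) \sw_(g1, g2 <- g) F (h1 * g1) (h2 * g2).
Proof.
move=> l1 l2; rewrite /sweedler2 comulM (tsum_lin _ _ (tsum_linear F)).
apply: eq_tsum => h1 h2; rewrite (tsum_lin _ _ (tsum_linear F)).
by apply: eq_tsum => g1 g2; rewrite tsumE.
Qed.

Lemma sw_counitl (k : fieldType) (H : hopfAlgebra k) (W : vectType k)
    (F : H -> W) (h : H) :
  linear F -> \sw_(a, b <- h) counit a *: F b = F h.
Proof.
move=> lF; rewrite -[in RHS](counitl h) (tsum_lin _ _ lF).
by apply: eq_sw => a b; rewrite linear_scale.
Qed.

Lemma sw_counitr (k : fieldType) (H : hopfAlgebra k) (W : vectType k)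
    (F : H -> W) (h : H) :
  linear F -> \sw_(a, b <- h) counit b *: F a = F h.
Proof.
move=> lF; rewrite -[in RHS](counitr h) (tsum_lin _ _ lF).
by apply: eq_sw => a b; rewrite linear_scale.
Qed.

Lemma sw_scalel (k : fieldType) (H : hopfAlgebra k) (W : vectType k) c (h : H)
    (F : H -> H -> W) :
  sweedler2 (c *: h) F = c *: sweedler2 h F.
Proof.
exact: (linear_scale (f := fun y => sweedler2 y F) (linear_swl _ (@linear_id _ _))).
Qed.

(** Typical T are the left-hand sides of the antipode axioms, as functions of
    the piece on which they are taken; this is how S(h_(i)) h_(i+1) cancels. *)
Lemma sw_absorbl (k : fieldType) (H : hopfAlgebra k) (W : vectType k)
    (T : H -> H) (F : H -> H -> W) (h : H) :
    (forall y, T y = counit y *: 1) ->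
    (forall b, linear (F^~ b)) -> (forall a, linear (F a)) ->
  \sw_(y, z <- h) F (T y) z = F 1 h.
Proof.
move=> TE l1 l2; rewrite -(sw_counitl h (l2 1)).
by apply: eq_sw => y z; rewrite TE (linear_scale (l1 z)).
Qed.

Lemma sw_absorbr (k : fieldType) (H : hopfAlgebra k) (W : vectType k)
    (T : H -> H) (F : H -> H -> W) (h : H) :
    (forall y, T y = counit y *: 1) ->
    (forall b, linear (F^~ b)) -> (forall a, linear (F a)) ->
  \sw_(z, y <- h) F z (T y) = F h 1.
Proof.
move=> TE l1 l2; rewrite -(sw_counitr h (l1 1)).
by apply: eq_sw => y z; rewrite TE (linear_scale (l2 y)).
Qed.

(** The same cancellation for a scalar T that uses one piece of each of two
    variables, such as R against its inverse. *)
Lemma sw_counit_ll (k : fieldType) (H : hopfAlgebra k) (W : vectType k)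
    (T : H -> H -> k) (F : H -> H -> W) (h g : H) :
    (forall y u, T y u = counit y * counit u) ->
    (forall b, linear (F^~ b)) -> (forall a, linear (F a)) ->
  \sw_(y, z <- h) \sw_(u, v <- g) T y u *: F z v = F h g.
Proof.
move=> TE l1 l2; rewrite -(sw_counitl h (l1 g)); apply: eq_sw => y z.
rewrite -(sw_counitl g (l2 z)) -sw_scale.
by apply: eq_sw => u v; rewrite TE scalerA.
Qed.

Lemma sw_counit_rl (k : fieldType) (H : hopfAlgebra k) (W : vectType k)
    (T : H -> H -> k) (F : H -> H -> W) (h g : H) :
    (forall y u, T y u = counit y * counit u) ->
    (forall b, linear (F^~ b)) -> (forall a, linear (F a)) ->
  \sw_(z, y <- h) \sw_(u, v <- g) T y u *: F z v = F h g.
Proof.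
move=> TE l1 l2; rewrite -(sw_counitr h (l1 g)); apply: eq_sw => z y.
rewrite -(sw_counitl g (l2 z)) -sw_scale.
by apply: eq_sw => u v; rewrite TE scalerA.
Qed.

Lemma sw_1 (k : fieldType) (H : hopfAlgebra k) (W : vectType k)
    (F : H -> H -> W) :
    (forall b, linear (F^~ b)) -> (forall a, linear (F a)) ->
  sweedler2 1 F = F 1 1.
Proof. by move=> l1 l2; rewrite /sweedler2 comul1 tsumE. Qed.

(** Extension point for the coproduct of an antipode. *)
Ltac sw_expand_antipode W := fail.

(** Extension point for identities that split a summand further, such as the
    multiplicativity of R. *)
Ltac sw_expand_body := idtac.

Ltac sw_represents_base :=
  lazymatch goal with
  | |- represents ?l ?s _ (n := ?n) _ =>
    let m := eval compute in (size s) in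
    unify n m; unify l (@nil nat);
    rewrite /represents; cbn [splits foldr napply head behead]; reflexivity
  end.

(** Finds the list of positions and the summand of a nested sum: coproducts of
    products are expanded, and a sum that occurs inside a linear expression is
    moved to the front. *)
Ltac sw_represents :=
  cbv beta;
  lazymatch goal with
  | |- @represents _ _ ?W _ _ (sweedler2 (_ * _) _) _ _ =>
    refine (represents_trans (@sw_mul _ _ W _ _ _ _ _) _); [lin | lin | sw_represents]
  | |- @represents _ _ ?W _ _ (sweedler2 (@GRing.one _) _) _ _ =>
    refine (represents_trans (@sw_1 _ _ W _ _ _) _); [lin | lin | sw_represents]
  | |- @represents _ _ ?W _ _ (sweedler2 (GRing.Linear.sort (@antipode _ _) _) _) _ _ =>
    sw_expand_antipode W; [lin | lin | sw_represents]
  | |- @represents _ _ ?W _ _ (sweedler2 (_ *: _) _) _ _ =>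
    refine (represents_trans (@sw_scalel _ _ W _ _ _) _); sw_represents
  | |- @represents _ _ ?W ?l ?s (sweedler2 (@sweedler2 ?k ?H ?U ?x ?G) ?K) ?n ?f =>
    refine (@represents_lin k H W U l s x G (fun y => @sweedler2 k H W y K) n f _ _);
    [lin | sw_represents]
  | |- represents _ ?s (sweedler2 ?x ?K) _ =>
    let rec pos t :=
      lazymatch t with
      | x :: _ => constr:(0%N)
      | _ :: ?t' => let i := pos t' in constr:(S i)
      end in
    let i := pos s in
    apply: (@represents_sw _ _ _ _ s i x); [reflexivity |];
    let a := fresh "a" in let b := fresh "b" in
    intros a b; cbn [take drop cat]; sw_represents
  | |- represents ?l ?s (tsum (_ ?x) ?K) ?f =>
    change (represents l s (sweedler2 x K) f); sw_represents
  | |- represents _ _ ?E _ =>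
    lazymatch E with
    | context [@sweedler2 ?k ?H ?U ?x ?K] =>
      let E' := eval pattern (@sweedler2 k H U x K) in E in
      lazymatch E' with
      | ?g _ =>
        lazymatch goal with
        | |- @represents _ _ ?W ?l ?s _ ?n ?f =>
          refine (@represents_lin k H W U l s x K g n f _ _);
          [lin | sw_represents]
        end
      end
    | _ => first [progress sw_expand_body; sw_represents | sw_represents_base]
    end
  end.

Ltac sw_body := rewrite -?scalerAl -?scalerAr ?tens_scalel ?tens_scaler ?scalerA ?mulrA;
  first [ done | ring | congr (_ *: _); ring | rewrite /GRing.scale /=; ring ].

(** Proves an equality of nested sums over the variables s that holds by
    coassociativity, exchange of sums and linearity; an equality of summands
    that is not plain commutative algebra is left to the user. *)
Ltac sw_auto s :=
  rewrite /sweedler3;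
  lazymatch goal with
  | |- @sweedler2 ?k ?H ?W _ _ = _ => eapply (@represents_eq k H W s)
  | |- _ = @sweedler2 ?k ?H ?W _ _ => eapply (@represents_eq k H W s)
  | _ => eapply (@represents_eq _ _ _ s)
  end;
  [ sw_represents | sw_represents | by vm_compute
  | cbn [nlinear nlinear_head]; repeat split; lin
  | cbn [nfun_eq]; intros; try sw_body ].

Ltac under_sw_with tac :=
  first [ tac; reflexivity
        | refine (eq_sw _ _); intros ? ?; under_sw_with tac ].

(** Rewrites inside the left-hand side, under as many sums as necessary. *)
Ltac under_sw tac := refine (etrans _ _); [under_sw_with tac |].

(** * Tensor products over the base *)
Section EqOverBase.
Variables (k : fieldType) (L : bialgebroidData k).
Hypothesis algL : is_algebra (btotal L).
Local Notation LL := (tensor (btotal L) (btotal L)).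

Lemma eq_over_base_refl (x y : LL) : x = y -> eq_over_base x y.
Proof. by move=> ->; exists [::]; rewrite subrr big_nil. Qed.

Lemma eq_over_base_balanced (b : bbase L) (X Y : btotal L) :
  eq_over_base ((btarget b ⋅ X) ⊗ Y) (X ⊗ (bsource b ⋅ Y)).
Proof. by exists [:: (b, X, Y)]; rewrite big_seq1. Qed.

Lemma eq_over_base_trans (y x z : LL) :
  eq_over_base x y -> eq_over_base y z -> eq_over_base x z.
Proof.
by move=> [r xy] [r' yz]; exists (r ++ r'); rewrite big_cat -xy -yz /= subrKA.
Qed.

Lemma eq_over_baseD (x y x' y' : LL) :
  eq_over_base x y -> eq_over_base x' y' -> eq_over_base (x + x') (y + y').
Proof.
move=> [r xy] [r' xy']; exists (r ++ r').
by rewrite big_cat -xy -xy' /= opprD addrACA.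
Qed.

Lemma eq_over_baseZ c (x y : LL) :
  eq_over_base x y -> eq_over_base (c *: x) (c *: y).
Proof.
move=> [r xy]; exists [seq (p.1.1, c *: p.1.2, p.2) | p <- r].
rewrite -scalerBr xy scaler_sumr big_map; apply: eq_bigr => -[[b X] Y] _ /=.
by rewrite (linear_scale (alg_mul_linearr algL _)) !tens_scalel scalerBr.
Qed.

Lemma eq_over_base_tsum U V (t : tensor U V) (F G : U -> V -> LL) :
    (forall a b, eq_over_base (F a b) (G a b)) ->
  eq_over_base (tsum t F) (tsum t G).
Proof.
move=> eqFG; pose K := @eq_over_base k L.
apply: (big_ind2 K); [exact: eq_over_base_refl | exact: eq_over_baseD |].
move=> i _; apply: (big_ind2 K).
- exact: eq_over_base_refl.
- exact: eq_over_baseD.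
- by move=> j _; apply: eq_over_baseZ.
Qed.

Lemma eq_over_base_ext U V (f g : tensor U V -> LL) :
    linear f -> linear g ->
    (forall a b, eq_over_base (f (a ⊗ b)) (g (a ⊗ b))) ->
  forall x, eq_over_base (f x) (g x).
Proof.
move=> lf lg eqfg x; rewrite -(tsum_tens x) (tsum_lin _ _ lf) (tsum_lin _ _ lg).
exact: eq_over_base_tsum.
Qed.
End EqOverBase.

(** * The action bialgebroid of a braided-commutative algebra *)
Section BraidedCommutative.
Variables (k : fieldType) (H : hopfAlgebra k).

Record is_braided_commutative (B : moduleComoduleAlgebraData H) : Prop :=
  IsBraidedCommutative {
  mca_algebra :> is_algebra B;
  act_linearl : forall h, linear (fun a : B => mca_act a h);
  act_linearr : forall a : B, linear (mca_act a);
  act1 : forall a : B, mca_act a 1 = a;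
  actM : forall (a : B) h g, mca_act (mca_act a h) g = mca_act a (h * g);
  act_unit : forall h, mca_act (alg_one B) h = counit h *: alg_one B;
  act_mul : forall (a b : B) h,
    mca_act (a ⋅ b) h = \sw_(h1, h2 <- h) mca_act a h1 ⋅ mca_act b h2;
  coact_linear : linear (@mca_coact k H B);
  coactA : forall a : B,
    \tsum_(a0, a1 <- mca_coact a) \tsum_(a00, a01 <- mca_coact a0) a00 ⊗ a01 ⊗ a1 =
    \tsum_(a0, a1 <- mca_coact a) a0 ⊗ comul a1;
  coact_counit : forall a : B,
    \tsum_(a0, a1 <- mca_coact a) counit a1 *: a0 = a;
  coact_unit : mca_coact (alg_one B) = alg_one B ⊗ 1;
  coact_mul : forall a b : B, mca_coact (a ⋅ b) =
    \tsum_(a0, a1 <- mca_coact a) \tsum_(b0, b1 <- mca_coact b)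
      (a0 ⋅ b0) ⊗ (a1 * b1);
  drinfeld_yetter : forall (b : B) h,
    \sw_(h1, h2 <- h) \tsum_(c0, c1 <- mca_coact (mca_act b h2)) c0 ⊗ (h1 * c1) =
    \tsum_(b0, b1 <- mca_coact b) \sw_(h1, h2 <- h) mca_act b0 h1 ⊗ (b1 * h2);
  braided_comm : forall a b : B,
    a ⋅ b = \tsum_(b0, b1 <- mca_coact b) b0 ⋅ mca_act a b1
}.

Lemma linear_algl (A : algebraData k) (U : vectType k) (f : U -> A) (c : A) :
  is_algebra A -> linear f -> linear (fun x => f x ⋅ c).
Proof. by move=> hA; apply: linear_comp (alg_mul_linearl hA c). Qed.

Lemma linear_algr (A : algebraData k) (U : vectType k) (f : U -> A) (c : A) :
  is_algebra A -> linear f -> linear (fun x => c ⋅ f x).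
Proof. by move=> hA; apply: linear_comp (alg_mul_linearr hA c). Qed.

Variables (B : moduleComoduleAlgebraData H) (U : vectType k).
Hypothesis bcB : is_braided_commutative B.

Lemma linear_actl (f : U -> B) (h : H) :
  linear f -> linear (fun x => mca_act (f x) h).
Proof. exact: linear_comp (act_linearl bcB h). Qed.

Lemma linear_actr (f : U -> H) (a : B) :
  linear f -> linear (fun x => mca_act a (f x)).
Proof. exact: linear_comp (act_linearr bcB a). Qed.

Lemma linear_coact (f : U -> B) :
  linear f -> linear (fun x => mca_coact (f x)).
Proof. exact: linear_comp (coact_linear bcB). Qed.

End BraidedCommutative.

Ltac lin_hook ::= first
  [ apply: linear_algl; [by eauto using mca_algebra | lin]
  | apply: linear_algr; [by eauto using mca_algebra | lin]
  | apply: linear_actl; [by eauto | lin]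
  | apply: linear_actr; [by eauto | lin]
  | apply: linear_coact; [by eauto | lin] ].

Section ActionAlgebroid.
Variables (k : fieldType) (H : hopfAlgebra k) (B : moduleComoduleAlgebraData H).
Hypothesis bcB : is_braided_commutative B.
Let algB : is_algebra B := mca_algebra bcB.
Local Notation L := (smash_opp B).
Local Notation "a # h" := (a ⊗ h : alg_space L) (at level 38).

Lemma smashE (a b : B) (h g : H) : (a # h) ⋅ (b # g) =
  \sw_(h1, h2 <- h) (a ⋅ mca_act b h1) # (g * h2).
Proof.
rewrite [LHS]tsumE; first (rewrite tsumE //; lin); lin.
Qed.

Lemma smash_linearl (y : L) : linear (fun x : L => x ⋅ y).
Proof. exact: tsum_linear. Qed.

Lemma smash_linearr (x : L) : linear (fun y : L => x ⋅ y).
Proof. apply: linear_tsumr => a h; exact: tsum_linear. Qed.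

(** The coaction axioms in the form used in computations: both sides of an
    equation in a tensor product are contracted with a multilinear F. *)
Lemma coact_coassoc (W : vectType k) (b : B) (F : B -> H -> H -> W) :
    (forall y z, linear (fun x => F x y z)) ->
    (forall x z, linear (fun y => F x y z)) ->
    (forall x y, linear (F x y)) ->
  \tsum_(b0, b1 <- mca_coact b) \tsum_(b00, b01 <- mca_coact b0) F b00 b01 b1 =
  \tsum_(b0, b1 <- mca_coact b) \sw_(x, y <- b1) F b0 x y.
Proof.
move=> l1 l2 l3.
pose ev (t : tensor B (tensor H H)) := \tsum_(b0, x <- t) \tsum_(b1, b2 <- x) F b0 b1 b2.
have lev : linear ev by exact: tsum_linear.
have evE b0 x : ev (b0 ⊗ x) = \tsum_(b1, b2 <- x) F b0 b1 b2.
  by rewrite /ev tsumE; [| lin | lin].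
have := congr1 ev (coactA bcB b); rewrite !(tsum_lin _ _ lev) => eq_ev.
transitivity (\tsum_(b0, b1 <- mca_coact b)
    ev (\tsum_(b00, b01 <- mca_coact b0) b00 ⊗ b01 ⊗ b1)).
  apply: eq_tsum => b0 b1; rewrite (tsum_lin _ _ lev).
  by apply: eq_tsum => x y; rewrite evE tsumE.
by rewrite eq_ev; apply: eq_tsum => b0 b1; rewrite evE.
Qed.

Lemma drinfeld_yetter_bilinear (W : vectType k) (b : B) (h : H) (F : B -> H -> W) :
    (forall y, linear (F^~ y)) -> (forall x, linear (F x)) ->
  \sw_(h1, h2 <- h) \tsum_(c0, c1 <- mca_coact (mca_act b h2)) F c0 (h1 * c1) =
  \tsum_(b0, b1 <- mca_coact b) \sw_(h1, h2 <- h) F (mca_act b0 h1) (b1 * h2).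
Proof.
move=> l1 l2; have lev := tsum_linear F.
have := congr1 (fun t => tsum t F) (drinfeld_yetter bcB b h).
rewrite /sweedler2 !(tsum_lin _ _ lev) => eq_ev.
transitivity (\sw_(h1, h2 <- h) tsum (\tsum_(c0, c1 <- mca_coact (mca_act b h2))
    c0 ⊗ (h1 * c1)) F).
  apply: eq_sw => h1 h2; rewrite (tsum_lin _ _ lev).
  by apply: eq_tsum => c0 c1; rewrite tsumE.
rewrite [LHS]eq_ev; apply: eq_tsum => b0 b1; rewrite (tsum_lin _ _ lev).
by apply: eq_tsum => h1 h2; rewrite tsumE.
Qed.

Lemma smash_algebra : is_algebra L.
Proof.
split; [exact: smash_linearl | exact: smash_linearr | | | ].
- move=> x y z; move: x; apply: tensor_ext.
  + by move=> c u v; rewrite smash_linearl.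
  + by move=> c u v; rewrite !smash_linearl.
  move=> a h; move: y; apply: tensor_ext.
  + by move=> c u v; rewrite smash_linearl smash_linearr.
  + by move=> c u v; rewrite smash_linearr smash_linearl.
  move=> b g; move: z; apply: tensor_ext.
  + by move=> c u v; rewrite !smash_linearr.
  + by move=> c u v; rewrite smash_linearr.
  move=> c f; rewrite !smashE.
  rewrite /sweedler2 (tsum_lin _ _ (smash_linearr _)) (tsum_lin _ _ (smash_linearl _)).
  rewrite -![tsum (comul _) _]/(sweedler2 _ _).
  transitivity (\sw_(g1, g2 <- g) \sw_(h1, h2, h3 <- h)
     (a ⋅ (mca_act b h1 ⋅ mca_act c (g1 * h2))) ⊗ (f * g2 * h3)).
    apply: eq_sw => g1 g2; rewrite smashE.
    under eq_sw => h1 h2 do rewrite act_mul //.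
    by under eq_sw => h1 h2 do under eq_sw => x y do rewrite actM //; sw_auto [:: h].
  transitivity (\sw_(h1, y <- h) \sw_(x, z <- g * y)
     (a ⋅ mca_act b h1 ⋅ mca_act c x) ⊗ (f * z)); last first.
    by apply: eq_sw => h1 h2; rewrite smashE.
  sw_auto [:: h; g]; rewrite !alg_mulA // mulrA //.
- apply: tensor_ext => [||a h]; [exact: smash_linearr | exact: linear_id |].
  rewrite smashE sw_1; [| lin | lin].
  by rewrite alg_mul1l // act1 // mulr1.
- apply: tensor_ext => [||a h]; [exact: smash_linearl | exact: linear_id |].
  rewrite smashE.
  under eq_sw => h1 h2.
    rewrite act_unit // (linear_scale (alg_mul_linearr algB _)) alg_mul1r //.
    rewrite mul1r tens_scalel; over.
  by rewrite (sw_counitl h (F := fun x => a # x)) //; lin.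
Qed.

Local Notation AL := (action_algebroid B).
Local Notation one := (alg_one B).

Lemma source_mul (b a : B) (h : H) :
  (@bsource k AL b : L) ⋅ (a # h) = (b ⋅ a) # h.
Proof.
by rewrite smashE sw_1; [rewrite act1 // mulr1 | lin | lin].
Qed.

(** The product is b_(0) (a ◁ b_(1)) # h b_(2) by definition, and braided
    commutativity absorbs the action: this is why the target map, although
    defined by the coaction, multiplies like an element of the base. *)
Lemma target_mul (b a : B) (h : H) :
  (@btarget k AL b : L) ⋅ (a # h) =
  \tsum_(b0, b1 <- mca_coact b) (a ⋅ b0) # (h * b1).
Proof.
transitivity (\tsum_(b0, x <- mca_coact b) \sw_(b1, b2 <- x)
    (b0 ⋅ mca_act a b1) # (h * b2)).
  rewrite -[@btarget _ _ _]tsum_tens (tsum_lin _ _ (smash_linearl _)).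
  by apply: eq_tsum => b0 b1; rewrite smashE.
rewrite -coact_coassoc; [| lin | lin | lin].
apply: eq_tsum => b0 b1.
rewrite braided_comm // (tsum_lin (f := fun y => y # (h * b1))) //; lin.
Qed.

Lemma act_target (b a : B) (h : H) :
  (a # h) ⋅ (@btarget k AL b : L) =
  \tsum_(b0, b1 <- mca_coact b) \sw_(h1, h2 <- h) (a ⋅ mca_act b0 h1) # (b1 * h2).
Proof.
rewrite -[@btarget _ _ _]tsum_tens (tsum_lin _ _ (smash_linearr _)).
by apply: eq_tsum => b0 b1; rewrite smashE.
Qed.

Lemma smash_source (b a : B) (h : H) :
  (a # h) ⋅ (@bsource k AL b : L) = \sw_(h1, h2 <- h) (a ⋅ mca_act b h1) # h2.
Proof. by rewrite smashE; apply: eq_sw => h1 h2; rewrite mul1r. Qed.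

Lemma action_comulE (a : B) (h : H) : @bcomul k AL (a # h) =
  \sw_(h1, h2 <- h) (a # h1) ⊗ (one # h2).
Proof. by rewrite [LHS]tsumE; [| lin | lin]. Qed.

Lemma action_counitE (a : B) (h : H) : @bcounit k AL (a # h) = counit h *: a.
Proof. by rewrite [LHS]tsumE; [| lin | lin]. Qed.

Lemma action_comul_linear : linear (@bcomul k AL).
Proof. exact: tsum_linear. Qed.

Lemma action_counit_linear : linear (@bcounit k AL).
Proof. exact: tsum_linear. Qed.

Lemma action_target_linear : linear (@btarget k AL).
Proof. exact: coact_linear. Qed.

Lemma tsum_action_comul (W : vectType k) (a : B) (h : H) (F : L -> L -> W) :
    (forall y, linear (F^~ y)) -> (forall x, linear (F x)) ->
  \tsum_(X, Y <- @bcomul k AL (a # h)) F X Y =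
  \sw_(h1, h2 <- h) F (a # h1) (one # h2).
Proof.
move=> l1 l2; rewrite action_comulE (tsum_lin _ _ (tsum_linear F)).
by apply: eq_sw => h1 h2; rewrite tsumE.
Qed.

Local Notation "a ≡ b" := (@eq_over_base k AL a b) (at level 70).

Let algL : is_algebra (btotal AL) := smash_algebra.

Ltac lin_hook ::= first
  [ apply: linear_algl; [first [eassumption | exact: algB | exact: algL] | lin]
  | apply: linear_algr; [first [eassumption | exact: algB | exact: algL] | lin]
  | apply: linear_actl; [eassumption | lin]
  | apply: linear_actr; [eassumption | lin]
  | apply: linear_coact; [eassumption | lin]
  | apply: (linear_comp action_comul_linear); lin
  | apply: (linear_comp action_counit_linear); lin
  | apply: (linear_comp action_target_linear); lin ].

Lemma source_algebra_map : algebra_map (@bsource k AL).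
Proof.
split=> //; first by move=> c u v; exact: tens_linearl.
by move=> a b; exact: esym (source_mul a b 1).
Qed.

Lemma target_algebra_antimap : algebra_antimap (@btarget k AL).
Proof.
split; [exact: coact_linear | exact: coact_unit | ].
move=> a b; rewrite -[in RHS](tsum_tens (@btarget k AL a : tensor B H)).
rewrite (tsum_lin _ _ (smash_linearr _)) [LHS](coact_mul bcB).
by apply: eq_tsum => a0 a1; rewrite target_mul; apply: eq_tsum => b0 b1.
Qed.

Lemma source_target_comm (b c : B) :
  (@bsource k AL b : L) ⋅ @btarget k AL c = (@btarget k AL c : L) ⋅ @bsource k AL b.
Proof.
rewrite target_mul -[in LHS](tsum_tens (@btarget k AL c : tensor B H)).
rewrite (tsum_lin _ _ (smash_linearr _)); apply: eq_tsum => c0 c1.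
by rewrite source_mul mul1r.
Qed.

Lemma action_comul_source (b : B) (X : L) : @bcomul k AL ((@bsource k AL b : L) ⋅ X) =
  \tsum_(X1, X2 <- @bcomul k AL X) ((@bsource k AL b : L) ⋅ X1) ⊗ X2.
Proof.
move: X; apply: tensor_ext.
- by lin.
- by lin.
move=> a h; rewrite source_mul action_comulE tsum_action_comul.
- by apply: eq_sw => h1 h2; rewrite source_mul.
- by lin.
- by lin.
Qed.

(** The second leg b_(0) # h_(2) b_(1) of the right-hand side is s(b_(0)) times
    1 # h_(2) b_(1); moving b_(0) across the tensor product over B makes it
    act through t on the first leg. *)
Lemma action_comul_target (b : B) (X : L) : @bcomul k AL ((@btarget k AL b : L) ⋅ X) ≡
  \tsum_(X1, X2 <- @bcomul k AL X) X1 ⊗ ((@btarget k AL b : L) ⋅ X2).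
Proof.
move: X; apply: (eq_over_base_ext algL).
- by lin.
- by lin.
move=> a h; rewrite target_mul tsum_action_comul; [| lin | lin].
rewrite (tsum_lin _ _ action_comul_linear).
apply: (@eq_over_base_trans k AL (\sw_(h1, h2 <- h) \tsum_(b0, b1 <- mca_coact b)
    ((@btarget k AL b0 : L) ⋅ (a # h1)) ⊗ (one # (h2 * b1)))).
  apply: eq_over_base_refl.
  transitivity (\sw_(h1, h2 <- h) \tsum_(b0, b1 <- mca_coact b) \sw_(x, y <- b1)
     ((a ⋅ b0) # (h1 * x)) ⊗ (one # (h2 * y))).
    rewrite [RHS]tsum_exchange; apply: eq_tsum => b0 b1; rewrite action_comulE.
    by sw_auto [:: h; b1].
  apply: eq_sw => h1 h2; rewrite -coact_coassoc; [| lin | lin | lin].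
  apply: eq_tsum => b0 b1; rewrite target_mul (tsum_lin (f := fun x => x ⊗ _)) //.
  exact: tens_linearl.
apply: (eq_over_base_tsum algL) => h1 h2; rewrite target_mul.
rewrite (tsum_lin (f := fun x => _ ⊗ x)); last exact: tens_linearr.
apply: (eq_over_base_tsum algL) => b0 b1.
apply: eq_over_base_trans (eq_over_base_balanced _ _ _) _.
by apply: eq_over_base_refl; rewrite source_mul alg_mul1r // alg_mul1l.
Qed.

Lemma action_counit_source (b : B) (X : L) :
  @bcounit k AL ((@bsource k AL b : L) ⋅ X) = b ⋅ @bcounit k AL X.
Proof.
move: X; apply: tensor_ext.
- by lin.
- by lin.
move=> a h; rewrite source_mul !action_counitE.
by rewrite (linear_scale (alg_mul_linearr algB _)).
Qed.

Lemma action_counit_target (b : B) (X : L) :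
  @bcounit k AL ((@btarget k AL b : L) ⋅ X) = @bcounit k AL X ⋅ b.
Proof.
move: X; apply: tensor_ext.
- by lin.
- by lin.
move=> a h; rewrite target_mul action_counitE (tsum_lin _ _ action_counit_linear).
rewrite -[in RHS](coact_counit bcB b) (tsum_lin _ _ (alg_mul_linearr algB _)).
apply: eq_tsum => b0 b1; rewrite action_counitE counitM.
rewrite (linear_scale (alg_mul_linearr algB _)).
by rewrite (linear_scale (alg_mul_linearl algB _)) scalerA mulrC.
Qed.

Lemma action_comulA (X : L) :
  \tsum_(X1, X2 <- @bcomul k AL X) \tsum_(X11, X12 <- @bcomul k AL X1)
     X11 ⊗ X12 ⊗ X2 =
  \tsum_(X1, X2 <- @bcomul k AL X) X1 ⊗ @bcomul k AL X2.
Proof.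
move: X; apply: tensor_ext.
- by lin.
- by lin.
move=> a h.
rewrite tsum_action_comul; [| by lin | by lin].
rewrite tsum_action_comul; [| by lin | by lin].
under eq_sw => h1 h2 do (rewrite tsum_action_comul; [| lin | lin]).
by under [RHS]eq_sw => h1 h2 do rewrite action_comulE; sw_auto [:: h].
Qed.

Lemma action_counitl (X : L) :
  \tsum_(X1, X2 <- @bcomul k AL X) (@bsource k AL (@bcounit k AL X1) : L) ⋅ X2 = X.
Proof.
move: X; apply: tensor_ext; [|exact: linear_id|move=> a h].
  by lin.
rewrite tsum_action_comul.
- under eq_sw => h1 h2 do rewrite source_mul alg_mul1r // action_counitE tens_scalel.
  by rewrite (sw_counitl h (F := fun x => a # x)) //; lin.
- by lin.
- by lin.
Qed.

Lemma action_counitr (X : L) :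
  \tsum_(X1, X2 <- @bcomul k AL X) (@btarget k AL (@bcounit k AL X2) : L) ⋅ X1 = X.
Proof.
move: X; apply: tensor_ext; [|exact: linear_id|move=> a h].
  by lin.
rewrite tsum_action_comul.
- under eq_sw => h1 h2.
    rewrite action_counitE (linear_scale action_target_linear).
    rewrite (linear_scale (smash_linearl _)) [X in X ⋅ _](coact_unit bcB).
    rewrite alg_mul1l; last exact: algL.
    over.
  by rewrite (sw_counitr h (F := fun x => a # x)) //; lin.
- by lin.
- by lin.
Qed.

(** Moving b ◁ h_(2) across the tensor product over B turns the right-hand side
    into t(b ◁ h_(2)) (a # h_(1)) ⊗ 1 # h_(3), and the Drinfeld-Yetter condition
    says that t(b ◁ h_(2)) (1 # h_(1)) = (1 # h) t(b). *)
Lemma action_comul_takeuchi (b : B) (X : L) :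
  \tsum_(X1, X2 <- @bcomul k AL X) (X1 ⋅ (@btarget k AL b : L)) ⊗ X2 ≡
  \tsum_(X1, X2 <- @bcomul k AL X) X1 ⊗ (X2 ⋅ (@bsource k AL b : L)).
Proof.
move: X; apply: (eq_over_base_ext algL).
- by lin.
- by lin.
move=> a h.
rewrite tsum_action_comul; [| by lin | by lin].
rewrite tsum_action_comul; [| by lin | by lin].
apply: (@eq_over_base_trans k AL (\sw_(x, h3 <- h) \sw_(h1, h2 <- x)
    ((@btarget k AL (mca_act b h2) : L) ⋅ (a # h1)) ⊗ (one # h3))).
  apply: eq_over_base_refl; apply: eq_sw => x h3.
  transitivity (\tsum_(b0, b1 <- mca_coact b) \sw_(h1, h2 <- x)
      ((a ⋅ mca_act b0 h1) # (b1 * h2)) ⊗ (one # h3)).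
    rewrite act_target (tsum_lin (f := fun y => y ⊗ _)); last exact: tens_linearl.
    apply: eq_tsum => b0 b1.
    by rewrite /sweedler2 (tsum_lin (f := fun y => y ⊗ _)) //; exact: tens_linearl.
  rewrite -(drinfeld_yetter_bilinear b x
     (F := fun c y => ((a ⋅ c) # y) ⊗ (one # h3))); [|lin|lin].
  apply: eq_sw => h1 h2; rewrite target_mul (tsum_lin (f := fun y => y ⊗ _)) //.
  exact: tens_linearl.
rewrite [X in X ≡ _]sw_coassoc; last first.
- by lin.
- by lin.
- by lin.
apply: (eq_over_base_tsum algL) => h1 x.
rewrite smash_source /sweedler2 (tsum_lin (f := fun y => _ ⊗ y)); last exact: tens_linearr.
apply: (eq_over_base_tsum algL) => h2 h3.
apply: eq_over_base_trans (eq_over_base_balanced _ _ _) _.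
by apply: eq_over_base_refl; rewrite source_mul alg_mul1r // alg_mul1l.
Qed.

Lemma action_comul1 : @bcomul k AL (alg_one L) = alg_one L ⊗ alg_one L.
Proof. by rewrite action_comulE sw_1; [| lin | lin]. Qed.

Lemma action_comulM (X Y : L) : @bcomul k AL (X ⋅ Y) =
  \tsum_(X1, X2 <- @bcomul k AL X) \tsum_(Y1, Y2 <- @bcomul k AL Y)
      (X1 ⋅ Y1) ⊗ (X2 ⋅ Y2).
Proof.
move: X; apply: tensor_ext.
- by lin.
- by lin.
move=> a h; move: Y; apply: tensor_ext.
- by lin.
- by lin.
move=> b g; rewrite tsum_action_comul.
- under [RHS]eq_sw => h1 h2.
    rewrite tsum_action_comul; [| by lin | by lin].
    under eq_sw => g1 g2 do rewrite !smashE.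
    over.
  rewrite smashE (tsum_lin _ _ action_comul_linear).
  transitivity (\sw_(h1, h2 <- h) \sw_(g1, g2 <- g)
      (\sw_(h11, h12 <- h1) (a ⋅ mca_act b h11) # (g1 * h12)) ⊗ (one # (g2 * h2))).
    rewrite -![tsum (comul _) _]/(sweedler2 _ _).
    under eq_sw => h1 h2 do rewrite action_comulE.
    by sw_auto [:: h; g].
  apply: eq_sw => h1 h2; apply: eq_sw => g1 g2; congr (_ ⊗ _).
  under eq_sw => x y.
    rewrite act_unit // (linear_scale (alg_mul_linearr algB _)) alg_mul1r //.
    rewrite tens_scalel; over.
  by rewrite (sw_counitl h2 (F := fun x => one # (g2 * x))) //; lin.
- by lin.
- by lin.
Qed.

Lemma action_counit1 : @bcounit k AL (alg_one L) = one.
Proof. by rewrite action_counitE counit1 scale1r. Qed.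

Lemma action_counit_mul (a b : B) (h g : H) :
  @bcounit k AL ((a # h) ⋅ (b # g)) = counit g *: (a ⋅ mca_act b h).
Proof.
rewrite smashE (tsum_lin _ _ action_counit_linear).
under eq_tsum => h1 h2 do rewrite action_counitE counitM mulrC -scalerA.
by apply: (sw_counitr h (F := fun x => counit g *: (a ⋅ mca_act b x))); lin.
Qed.

Lemma action_counitM_source (X Y : L) : @bcounit k AL (X ⋅ Y) =
  @bcounit k AL (X ⋅ (@bsource k AL (@bcounit k AL Y) : L)).
Proof.
move: X; apply: tensor_ext; [by lin | by lin |].
move=> a h; move: Y; apply: tensor_ext.
- by lin.
- by lin.
move=> b g; rewrite !action_counit_mul action_counitE counit1 scale1r.
by rewrite (linear_scale (act_linearl bcB _)) (linear_scale (alg_mul_linearr algB _)).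
Qed.

Lemma action_counitM_target (X Y : L) : @bcounit k AL (X ⋅ Y) =
  @bcounit k AL (X ⋅ (@btarget k AL (@bcounit k AL Y) : L)).
Proof.
move: X; apply: tensor_ext; [by lin | by lin |].
move=> a h; move: Y; apply: tensor_ext.
- by lin.
- by lin.
move=> b g; rewrite action_counit_mul action_counitE (linear_scale action_target_linear).
rewrite (linear_scale (smash_linearr _)) (linear_scale action_counit_linear).
congr (_ *: _); rewrite -[@btarget _ _ _]tsum_tens (tsum_lin _ _ (smash_linearr _)).
rewrite (tsum_lin _ _ action_counit_linear).
transitivity (a ⋅ mca_act (\tsum_(b0, b1 <- mca_coact b) counit b1 *: b0) h).
  by rewrite coact_counit.
rewrite (tsum_lin _ _ (act_linearl bcB h)) (tsum_lin _ _ (alg_mul_linearr algB a)).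
apply: eq_tsum => b0 b1; rewrite action_counit_mul.
by rewrite (linear_scale (act_linearl bcB _)) (linear_scale (alg_mul_linearr algB _)).
Qed.

Theorem action_algebroid_left_bialgebroid : is_left_bialgebroid AL.
Proof.
split; [exact: algB | exact: algL | exact: source_algebra_map
  | exact: target_algebra_antimap | exact: source_target_comm
  | exact: action_comul_linear | | exact: action_comul_target
  | exact: action_counit_linear | exact: action_counit_source | exact: action_counit_target
  | | exact: action_counitl | exact: action_counitr | exact: action_comul_takeuchi | |
  | exact: action_counit1 | exact: action_counitM_source
  | exact: action_counitM_target].
- by move=> b X; apply: eq_over_base_refl; exact: action_comul_source.
- by move=> X; exists [::], [::]; rewrite !big_nil addr0 action_comulA subrr.
- by apply: eq_over_base_refl; exact: action_comul1.
- by move=> X Y; apply: eq_over_base_refl; exact: action_comulM.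
Qed.
End ActionAlgebroid.

(** * The antipode *)
Section Antipode.
Variables (k : fieldType) (H : hopfAlgebra k).
Implicit Types h g : H.

Lemma sw_antipodel (W : vectType k) (F : H -> W) h :
  linear F -> \sw_(a, b <- h) F (antipode a * b) = counit h *: F 1.
Proof.
by move=> lF; rewrite -(linear_scale lF) -antipodel (tsum_lin _ _ lF).
Qed.

Lemma sw_antipoder (W : vectType k) (F : H -> W) h :
  linear F -> \sw_(a, b <- h) F (a * antipode b) = counit h *: F 1.
Proof.
by move=> lF; rewrite -(linear_scale lF) -antipoder (tsum_lin _ _ lF).
Qed.

Lemma antipode1 : antipode 1 = 1 :> H.
Proof.
have := sw_antipodel 1 (@linear_id _ H).
by rewrite sw_1; [rewrite counit1 scale1r mulr1 | lin | lin].
Qed.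

(** Both sides are inverse to the multiplication for convolution: the middle
    expression S(h_(1) g_(1)) h_(2) g_(2) S(g_(3)) S(h_(3)) collapses to
    either. *)
Lemma antipodeM h g : antipode (h * g) = antipode g * antipode h.
Proof.
transitivity (\sw_(h1, h' <- h) \sw_(g1, g' <- g) \sw_(h2, h3 <- h')
    antipode (h1 * g1) * (h2 * (\sw_(g2, g3 <- g') g2 * antipode g3) * antipode h3)).
  transitivity (\sw_(h1, h' <- h) counit h' *:
      \sw_(g1, g' <- g) counit g' *: antipode (h1 * g1)).
    rewrite (sw_counitr h (F := fun x =>
      \sw_(g1, g' <- g) counit g' *: antipode (x * g1))); last by lin.
    by rewrite (sw_counitr g (F := fun x => antipode (h * x))) //; lin.
  apply: eq_sw => h1 h'; rewrite -sw_scale; apply: eq_sw => g1 g'.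
  under [RHS]eq_sw => h2 h3.
    rewrite [X in _ * X * _]antipoder -scalerAr mulr1 -scalerAl -scalerAr; over.
  rewrite sw_scale (sw_antipoder _ (F := fun x => antipode (h1 * g1) * x)); last by lin.
  by rewrite mulr1 !scalerA mulrC.
transitivity (\sw_(h', h3 <- h) \sw_(g', g3 <- g)
   (\sw_(x, y <- h' * g') antipode x * y) * (antipode g3 * antipode h3)).
  by sw_auto [:: h; g].
transitivity (\sw_(h', h3 <- h) counit h' *: \sw_(g', g3 <- g)
   counit g' *: (antipode g3 * antipode h3)).
  apply: eq_sw => h' h3; rewrite -sw_scale; apply: eq_sw => g' g3.
  by rewrite [X in X * _]antipodel counitM -scalerAl mul1r scalerA.
rewrite (sw_counitl h (F := fun x =>
  \sw_(g', g3 <- g) counit g' *: (antipode g3 * antipode x))); last by lin.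
by rewrite (sw_counitl g (F := fun x => antipode x * antipode h)) //; lin.
Qed.

Lemma counit_antipode h : counit (antipode h) = counit h.
Proof.
have lc : linear (fun x : H => counit x : k^o) by lin.
transitivity (\sw_(a, b <- h) (counit b *: (counit (antipode a) : k^o))).
  by rewrite (@sw_counitr k H k^o (fun x => counit (antipode x)) h) //; lin.
transitivity (\sw_(a, b <- h) (counit (antipode a * b) : k^o)).
  (* the value space k^o has to be given, since scalars are typed in k *)
  by apply: (@eq_sw k H k^o) => a b; rewrite counitM mulrC.
rewrite (sw_antipodel h lc) counit1 /GRing.scale /=; exact: mulr1.
Qed.

(** Anticomultiplicativity of the antipode: the coproduct of S(h_(1)), multiplied
    by h_(2) S(h_(5)) ⊗ h_(3) S(h_(4)), collapses to either side.  The map K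
    below is this product under F. *)
Lemma sw_antipode (W : vectType k) (F : H -> H -> W) h :
    (forall b, linear (F^~ b)) -> (forall a, linear (F a)) ->
  sweedler2 (antipode h) F = \sw_(h1, h2 <- h) F (antipode h2) (antipode h1).
Proof.
move=> l1 l2.
pose K h1 a b c d := \sw_(x, y <- antipode h1) F (x * (a * antipode d)) (y * (b * antipode c)).
have lK1 a b c d : linear (fun x => K x a b c d) by lin.
have lK2 x b c d : linear (fun a => K x a b c d).
  by apply: linear_swr => *; apply: (linear_comp (l1 _)); lin.
have lK3 x a c d : linear (fun b => K x a b c d).
  by apply: linear_swr => *; apply: (linear_comp (l2 _)); lin.
have lK4 x a b d : linear (fun c => K x a b c d).
  by apply: linear_swr => *; apply: (linear_comp (l2 _)); lin.
have lK5 x a b c : linear (K x a b c).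
  by apply: linear_swr => *; apply: (linear_comp (l1 _)); lin.
transitivity (\sw_(h1, z <- h) \sw_(h2, w <- z) \sw_(u, h5 <- w) \sw_(h3, h4 <- u)
    K h1 h2 h3 h4 h5).
  transitivity (\sw_(h1, z <- h) counit z *: sweedler2 (antipode h1) F).
    by rewrite (sw_counitr h (F := fun x => sweedler2 (antipode x) F)) //; lin.
  apply: eq_sw => h1 z; symmetry.
  transitivity (\sw_(x, y <- antipode h1) \sw_(h2, w <- z) \sw_(u, h5 <- w)
     \sw_(h3, h4 <- u) F (x * (h2 * antipode h5)) (y * (h3 * antipode h4))).
    rewrite [RHS]tsum_exchange; apply: eq_tsum => h2 w.
    rewrite [RHS]tsum_exchange; apply: eq_tsum => u h5.
    by rewrite [RHS]tsum_exchange.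
  rewrite -sw_scale; apply: eq_sw => x y.
  transitivity (\sw_(h2, w <- z) \sw_(u, h5 <- w) counit u *: F (x * (h2 * antipode h5)) y).
    apply: eq_sw => h2 w; apply: eq_sw => u h5.
    rewrite (sw_antipoder u (F := fun t => F (x * (h2 * antipode h5)) (y * t))).
      by rewrite mulr1.
    by apply: (linear_comp (l2 _)); lin.
  transitivity (\sw_(h2, w <- z) F (x * (h2 * antipode w)) y).
    apply: eq_sw => h2 w; apply: (sw_counitl w (F := fun t => F (x * (h2 * antipode t)) y)).
    by apply: (linear_comp (l1 _)); lin.
  rewrite (sw_antipoder z (F := fun t => F (x * t) y)); first by rewrite mulr1.
  by apply: (linear_comp (l1 _)); lin.
transitivity (\sw_(p, q <- h) \sw_(h1, r <- p) \sw_(a, b <- r) \sw_(c, d <- q) K h1 a b c d).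
  by clearbody K; sw_auto [:: h].
transitivity (\sw_(p, q <- h) counit p *: \sw_(c, d <- q) F (antipode d) (antipode c)).
  apply: eq_sw => p q.
  transitivity (\sw_(h1, r <- p) \sw_(c, d <- q) \sw_(x, y <- antipode h1 * r)
      F (x * antipode d) (y * antipode c)).
    apply: eq_sw => h1 r; rewrite sw_exchange; apply: eq_sw => c d.
    rewrite sw_mul; last 2 first.
    - by move=> b; apply: (linear_comp (l1 _)); lin.
    - by move=> b; apply: (linear_comp (l2 _)); lin.
    rewrite /K sw_exchange; apply: eq_sw => x y; apply: eq_sw => a b.
    by rewrite !mulrA.
  rewrite sw_exchange -sw_scale; apply: eq_sw => c d.
  rewrite (sw_antipodel p (F := fun t => \sw_(x, y <- t) F (x * antipode d) (y * antipode c))).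
    rewrite sw_1 ?mul1r //.
    - by move=> b; apply: (linear_comp (l1 _)); lin.
    - by move=> b; apply: (linear_comp (l2 _)); lin.
  by lin.
apply: (sw_counitl h (F := fun q => \sw_(c, d <- q) F (antipode d) (antipode c))).
by lin.
Qed.
End Antipode.

Ltac sw_expand_antipode W ::=
  refine (represents_trans (@sw_antipode _ _ W _ _ _ _) _).

(** * The dual of H as a braided-commutative algebra *)
Section DualModule.
Variables (k : fieldType) (H : hopfAlgebra k).
Implicit Types (a b c : dual H) (h g x y : H).

Lemma dual_expand a : a = \sum_(i < \dim {: H}) a (vbasis {: H})`_i *: dual_basis i.
Proof.
apply/lfunP => h; rewrite sum_lfunE [in LHS](coord_vbasis (memvf h)) linear_sum.
apply: eq_bigr => i _; rewrite linearZ scale_lfunE dual_basisE /=.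
by rewrite /GRing.scale /= mulrC.
Qed.

(** Since H is finite-dimensional, H^* ⊗ W is the space of linear maps from H to
    W; this is the value at x of the map that corresponds to t. *)
Definition dual_eval (W : vectType k) x (t : tensor (dual H) W) : W :=
  \tsum_(a, w <- t) (a x : k) *: w.

Lemma dual_eval_linear (W : vectType k) x : linear (@dual_eval W x).
Proof. exact: tsum_linear. Qed.

Lemma dual_eval_tens (W : vectType k) x a (w : W) : dual_eval x (a ⊗ w) = (a x : k) *: w.
Proof. by rewrite /dual_eval tsumE //; lin. Qed.

Lemma dual_eval_inj (W : vectType k) (t t' : tensor (dual H) W) :
  (forall x, dual_eval x t = dual_eval x t') -> t = t'.
Proof.
pose f (t : tensor (dual H) W) :=
  \sum_(i < \dim {: H}) dual_basis i ⊗ dual_eval (vbasis {: H})`_i t.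
have fE t0 : f t0 = t0.
  move: t0; apply: tensor_ext => [c u v|//|a w].
    rewrite /f scaler_sumr -big_split; apply: eq_bigr => i _ /=.
    by rewrite dual_eval_linear tens_linearr.
  rewrite [a in RHS]dual_expand /f.
  rewrite (linear_sumE (tens_linearl w)); apply: eq_bigr => i _.
  by rewrite dual_eval_tens tens_scaler /= tens_scalel.
move=> eq_ev; rewrite -(fE t) -(fE t') /f.
by apply: eq_bigr => i _; rewrite eq_ev.
Qed.

Lemma dual_mulE a b x : dual_mul a b x = \sw_(x1, x2 <- x) (a x1 * b x2 : k^o).
Proof. exact: sweedler_formE. Qed.

Lemma dual_eval_form x : linear (fun a : dual H => a x).
Proof. by move=> c u v; rewrite add_lfunE scale_lfunE. Qed.

Lemma dual_actE a h x : dual_act a h x = a (h * x).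
Proof.
rewrite -dual_comulE /dual_act (tsum_lin _ _ (dual_eval_form x)).
by apply: eq_tsum => a1 a2; rewrite scale_lfunE.
Qed.

Lemma dual_coadjointE a b x : dual_coadjoint a b x =
  \sw_(x1, x2, x3 <- x) (a x2 * b (x1 * antipode x3) : k^o).
Proof.
rewrite /dual_coadjoint (tsum_lin _ _ (dual_eval_form x)).
transitivity (\tsum_(b1, b2 <- dual_comul b) \sw_(x1, x2, x3 <- x)
    (a x2 * (b1 x1 * b2 (antipode x3)) : k^o)).
  apply: eq_tsum => b1 b2; rewrite dual_mulE.
  transitivity (\sw_(x', x3 <- x) (\sw_(x1, x2 <- x') (b1 x1 * a x2 : k^o)) *
     b2 (antipode x3) : k^o).
    by apply: eq_sw => x' x3; rewrite dual_mulE dual_antipodeE.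
  by sw_auto [:: x].
rewrite tsum_exchange; apply: eq_sw => x1 x'.
rewrite tsum_exchange; apply: eq_sw => x2 x3.
by rewrite tsum_scale dual_comulE.
Qed.

(** The defining property of the coaction, which pairs its second leg with all
    linear forms, determines that leg as an element of H. *)
Lemma dual_coact_eval a x :
  dual_eval x (dual_coact a) = \sw_(x1, x2, x3 <- x) (a x2 : k) *: (x1 * antipode x3).
Proof.
have eq_coord (y z : H) :
    (forall i, coord (vbasis {: H}) i y = coord (vbasis {: H}) i z) -> y = z.
  move=> eqyz; rewrite (coord_vbasis (memvf y)) (coord_vbasis (memvf z)).
  by apply: eq_bigr => i _; rewrite eqyz.
apply: eq_coord => i; rewrite -!dual_basisE.
set b := dual_basis i.
have lb : linear b by move=> c u v; rewrite linearP.
rewrite /dual_eval (tsum_lin _ _ lb).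
transitivity (dual_coadjoint a b x).
  rewrite -dual_coactE (tsum_lin _ _ (dual_eval_form x)).
  apply: (@eq_tsum k (dual H) H k^o) => a0 a1; rewrite scale_lfunE linearZ; exact: mulrC.
rewrite dual_coadjointE (sw_lin _ _ lb); apply: (@eq_sw k H k^o) => x1 x'.
by rewrite (sw_lin _ _ lb); apply: (@eq_sw k H k^o) => x2 x3; rewrite linearZ.
Qed.

Lemma dual_coact_contract (W : vectType k) (G : H -> W) b y : linear G ->
  \tsum_(b0, b1 <- dual_coact b) (b0 y : k) *: G b1 =
  \sw_(y1, y2, y3 <- y) (b y2 : k) *: G (y1 * antipode y3).
Proof.
move=> lG; transitivity (G (dual_eval y (dual_coact b))).
  by rewrite /dual_eval (tsum_lin _ _ lG); apply: eq_tsum => b0 b1; rewrite linear_scale.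
rewrite dual_coact_eval (sw_lin _ _ lG); apply: eq_sw => y1 y'.
by rewrite (sw_lin _ _ lG); apply: eq_sw => y2 y3; rewrite linear_scale.
Qed.

Lemma dual_mul_linearl b : linear (fun a => dual_mul a b).
Proof.
move=> c u v; apply/lfunP => x; rewrite add_lfunE scale_lfunE !dual_mulE.
have lx : linear (fun a : dual H => \sw_(x1, x2 <- x) (a x1 * b x2 : k^o)) by lin.
exact: lx.
Qed.

Lemma dual_mul_linearr a : linear (dual_mul a).
Proof.
move=> c u v; apply/lfunP => x; rewrite add_lfunE scale_lfunE !dual_mulE.
have lx : linear (fun b : dual H => \sw_(x1, x2 <- x) (a x1 * b x2 : k^o)) by lin.
exact: lx.
Qed.

Lemma dual_algebraP : is_algebra (dual_algebra H).
Proof.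
split; [exact: dual_mul_linearl | exact: dual_mul_linearr | | | ].
- move=> a b c; apply/lfunP => x; rewrite !dual_mulE.
  transitivity (\sw_(x1, x' <- x) (a x1 * (\sw_(x2, x3 <- x') (b x2 * c x3 : k^o) : k) : k^o)).
    by apply: (@eq_sw k H k^o) => x1 x'; rewrite dual_mulE.
  transitivity (\sw_(x', x3 <- x) ((\sw_(x1, x2 <- x') (a x1 * b x2 : k^o) : k) * c x3 : k^o)).
    by sw_auto [:: x].
  by apply: (@eq_sw k H k^o) => x1 x'; rewrite dual_mulE.
- move=> a; apply/lfunP => x; rewrite dual_mulE.
  rewrite -[RHS](@sw_counitl k H k^o a x); last by lin.
  by apply: (@eq_sw k H k^o) => x1 x2; rewrite dual_oneE.
- move=> a; apply/lfunP => x; rewrite dual_mulE.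
  rewrite -[RHS](@sw_counitr k H k^o a x); last by lin.
  by apply: (@eq_sw k H k^o) => x1 x2; rewrite dual_oneE mulrC.
Qed.

Lemma dual_act_linearl h : linear (fun a => dual_act a h).
Proof.
move=> c u v; apply/lfunP => x; rewrite add_lfunE scale_lfunE !dual_actE.
by rewrite add_lfunE scale_lfunE.
Qed.

Lemma dual_act_linearr a : linear (dual_act a).
Proof.
move=> c u v; apply/lfunP => x; rewrite add_lfunE scale_lfunE !dual_actE.
by rewrite mulrDl -scalerAl linearP.
Qed.

Lemma dual_coact_linear : linear (@dual_coact k H).
Proof.
move=> c u v; apply: dual_eval_inj => x; rewrite dual_eval_linear !dual_coact_eval.
have lx : linear (fun b : dual H =>
    \sw_(x1, x2, x3 <- x) (b x2 : k) *: (x1 * antipode x3)).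
  by rewrite /sweedler3; lin.
exact: lx.
Qed.

Lemma dual_act_mul a b h :
  dual_act (dual_mul a b) h = \sw_(h1, h2 <- h) dual_mul (dual_act a h1) (dual_act b h2).
Proof.
apply/lfunP => x; rewrite dual_actE dual_mulE (sw_lin _ _ (dual_eval_form x)).
transitivity (\sw_(h1, h2 <- h) \sw_(x1, x2 <- x) (a (h1 * x1) * b (h2 * x2) : k^o)).
  by sw_auto [:: h; x].
apply: (@eq_sw k H k^o) => h1 h2; rewrite dual_mulE.
by apply: (@eq_sw k H k^o) => x1 x2; rewrite !dual_actE.
Qed.

Lemma dual_coactA a :
  \tsum_(a0, a1 <- dual_coact a) \tsum_(a00, a01 <- dual_coact a0) a00 ⊗ a01 ⊗ a1 =
  \tsum_(a0, a1 <- dual_coact a) a0 ⊗ comul a1.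
Proof.
apply: dual_eval_inj => x.
rewrite !(tsum_lin _ _ (dual_eval_linear x)).
transitivity (\sw_(x1, x2, x3 <- x) \tsum_(a0, a1 <- dual_coact a)
    (a0 x2 : k) *: ((x1 * antipode x3) ⊗ a1)).
  rewrite /sweedler3; under [RHS]eq_sw => x1 x' do rewrite sw_tsum_exchange.
  rewrite sw_tsum_exchange; apply: eq_tsum => a0 a1.
  rewrite (tsum_lin _ _ (dual_eval_linear x)).
  rewrite -[RHS](dual_coact_contract a0 x (G := fun y => y ⊗ a1)); last by lin.
  by apply: eq_tsum => a00 a01; rewrite dual_eval_tens.
transitivity (\sw_(x1, x2, x3 <- x) \sw_(y1, y2, y3 <- x2)
    (a y2 : k) *: ((x1 * antipode x3) ⊗ (y1 * antipode y3))).
  apply: eq_sw => x1 x'; apply: eq_sw => x2 x3.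
  by rewrite dual_coact_contract; last by lin.
transitivity (\sw_(x1, x2, x3 <- x) (a x2 : k) *: (\sw_(y, z <- x1 * antipode x3) y ⊗ z)).
  by sw_auto [:: x]; rewrite ?antipodeM ?mulrA.
transitivity (\tsum_(a0, a1 <- dual_coact a) (a0 x : k) *: comul a1).
  rewrite dual_coact_contract; last by lin.
  by apply: eq_sw => x1 x'; apply: eq_sw => x2 x3; rewrite [X in _ *: X]tsum_tens.
by apply: eq_tsum => a0 a1; rewrite dual_eval_tens.
Qed.

Lemma dual_coact_counit a :
  \tsum_(a0, a1 <- dual_coact a) counit a1 *: a0 = a.
Proof.
apply/lfunP => x; rewrite (tsum_lin _ _ (dual_eval_form x)).
transitivity (\tsum_(a0, a1 <- dual_coact a) ((a0 x : k) *: (counit a1 : k^o) : k^o)).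
  by apply: (@eq_tsum k (dual H) H k^o) => a0 a1; rewrite scale_lfunE [LHS]mulrC.
rewrite (@dual_coact_contract k^o); last by lin.
transitivity (\sw_(x1, x' <- x) counit x1 *: \sw_(x2, x3 <- x') counit x3 *: a x2).
  apply: (@eq_sw k H k^o) => x1 x'; rewrite -sw_scale.
  apply: (@eq_sw k H k^o) => x2 x3.
  by rewrite counitM counit_antipode [LHS]mulrC -[LHS]mulrA.
rewrite (@sw_counitl k H k^o (fun y => \sw_(x2, x3 <- y) counit x3 *: a x2)); last by lin.
by rewrite (@sw_counitr k H k^o a x) //; lin.
Qed.

Lemma dual_coact_unit : dual_coact (dual_one H) = dual_one H ⊗ (1 : H).
Proof.
apply: dual_eval_inj => x; rewrite dual_coact_eval dual_eval_tens dual_oneE.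
rewrite -[counit x *: 1]antipoder; apply: eq_sw => x1 x'.
rewrite -(sw_counitl x' (F := fun y => x1 * antipode y)); last by lin.
by apply: eq_sw => x2 x3; rewrite dual_oneE.
Qed.

Lemma dual_coact_mul a b : dual_coact (dual_mul a b) =
  \tsum_(a0, a1 <- dual_coact a) \tsum_(b0, b1 <- dual_coact b)
     dual_mul a0 b0 ⊗ (a1 * b1).
Proof.
apply: dual_eval_inj => x; rewrite dual_coact_eval (tsum_lin _ _ (dual_eval_linear x)).
transitivity (\sw_(u, v <- x) \tsum_(a0, a1 <- dual_coact a) (a0 u : k) *:
   \tsum_(b0, b1 <- dual_coact b) (b0 v : k) *: (a1 * b1)); last first.
  rewrite sw_tsum_exchange; apply: eq_tsum => a0 a1.
  rewrite (tsum_lin _ _ (dual_eval_linear x)).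
  transitivity (\sw_(u, v <- x) \tsum_(b0, b1 <- dual_coact b)
      (a0 u : k) *: ((b0 v : k) *: (a1 * b1))).
    by apply: eq_sw => u v; rewrite tsum_scale.
  rewrite sw_tsum_exchange; apply: eq_tsum => b0 b1.
  have lx : linear (fun c : k^o => (c : k) *: (a1 * b1)) by lin.
  rewrite dual_eval_tens dual_mulE (sw_lin _ _ lx).
  by apply: eq_sw => u v; rewrite scalerA.
transitivity (\sw_(u, v <- x) \sw_(u1, u2, u3 <- u) \sw_(v1, v2, v3 <- v)
   ((a u2 : k) * b v2) *: (u1 * antipode u3 * (v1 * antipode v3))); last first.
  apply: eq_sw => u v; rewrite dual_coact_contract; last by lin.
  apply: eq_sw => u1 u'; apply: eq_sw => u2 u3.
  rewrite dual_coact_contract; last by lin.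
  rewrite /sweedler3 -sw_scale; apply: eq_sw => v1 v'; rewrite -sw_scale.
  by apply: eq_sw => v2 v3; rewrite scalerA.
transitivity (\sw_(x1, x' <- x) \sw_(x2, y <- x') \sw_(z, w <- y) \sw_(x3, x4 <- w)
   ((a x2 : k) * b x3) *:
      (x1 * (\sw_(p, q <- z) antipode p * q) * antipode x4)); last first.
  by sw_auto [:: x].
transitivity (\sw_(x1, x' <- x) \sw_(x2, w <- x') \sw_(x3, x4 <- w)
   ((a x2 : k) * b x3) *: (x1 * antipode x4)).
  apply: eq_sw => x1 x'; under eq_sw => u v do rewrite dual_mulE.
  by sw_auto [:: x'].
apply: eq_sw => x1 x'; apply: eq_sw => x2 y.
rewrite -(sw_counitl y (F := fun w =>
  \sw_(x3, x4 <- w) ((a x2 : k) * b x3) *: (x1 * antipode x4))); last by lin.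
apply: eq_sw => z w; rewrite -sw_scale; apply: eq_sw => x3 x4.
by rewrite [X in _ * X * _]antipodel -scalerAr mulr1 -scalerAl !scalerA mulrC.
Qed.

Lemma dual_drinfeld_yetter b h :
  \sw_(h1, h2 <- h) \tsum_(c0, c1 <- dual_coact (dual_act b h2)) c0 ⊗ (h1 * c1) =
  \tsum_(b0, b1 <- dual_coact b) \sw_(h1, h2 <- h) dual_act b0 h1 ⊗ (b1 * h2).
Proof.
apply: dual_eval_inj => x.
rewrite (tsum_lin _ _ (dual_eval_linear x)) (sw_lin _ _ (dual_eval_linear x)).
transitivity (\sw_(h1, h2 <- h) \sw_(x1, x2, x3 <- x)
   (b (h2 * x2) : k) *: (h1 * (x1 * antipode x3))).
  apply: eq_sw => h1 h2; rewrite (tsum_lin _ _ (dual_eval_linear x)).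
  under eq_tsum => c0 c1 do rewrite dual_eval_tens.
  rewrite dual_coact_contract; last by lin.
  by apply: eq_sw => x1 x'; apply: eq_sw => x2 x3; rewrite dual_actE.
transitivity (\sw_(h1, h2 <- h) \sw_(y1, y2, y3 <- h1 * x)
   (b y2 : k) *: (y1 * antipode y3 * h2)); last first.
  under [RHS]eq_tsum => b0 b1 do rewrite (sw_lin _ _ (dual_eval_linear x)).
  rewrite -sw_tsum_exchange; apply: eq_sw => h1 h2.
  rewrite -(dual_coact_contract b (h1 * x) (G := fun y => y * h2)); last by lin.
  by apply: eq_tsum => b0 b1; rewrite dual_eval_tens dual_actE.
transitivity (\sw_(h1, h' <- h) \sw_(h2, z <- h') \sw_(x1, x2, x3 <- x)
   (b (h2 * x2) : k) *:
      (h1 * x1 * antipode x3 * (\sw_(p, q <- z) antipode p * q))); last first.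
  by sw_auto [:: h; x]; rewrite antipodeM !mulrA.
apply: eq_sw => h1 h'.
rewrite -(sw_counitr h' (F := fun h2 => \sw_(x1, x2, x3 <- x)
  (b (h2 * x2) : k) *: (h1 * (x1 * antipode x3)))); last by rewrite /sweedler3; lin.
apply: eq_sw => h2 z; rewrite /sweedler3 -sw_scale; apply: eq_sw => x1 x'.
rewrite -sw_scale; apply: eq_sw => x2 x3.
by rewrite [sweedler2 z _]antipodel -scalerAr mulr1 !scalerA mulrC !mulrA.
Qed.

Lemma dual_braided_comm a b :
  dual_mul a b = \tsum_(b0, b1 <- dual_coact b) dual_mul b0 (dual_act a b1).
Proof.
apply/lfunP => x; rewrite dual_mulE (tsum_lin _ _ (dual_eval_form x)).
transitivity (\sw_(u, v <- x) \sw_(u1, u2, u3 <- u)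
   (b u2 : k) *: a (u1 * antipode u3 * v)); last first.
  under [RHS]eq_tsum => b0 b1 do rewrite dual_mulE.
  rewrite -sw_tsum_exchange; apply: (@eq_sw k H k^o) => u v.
  rewrite -(@dual_coact_contract k^o (fun y => a (y * v))); last by lin.
  by apply: (@eq_tsum k (dual H) H k^o) => b0 b1; rewrite dual_actE.
transitivity (\sw_(x1, x' <- x) \sw_(x2, z <- x')
   (b x2 : k) *: a (x1 * (\sw_(p, q <- z) antipode p * q))); last first.
  by sw_auto [:: x].
apply: (@eq_sw k H k^o) => x1 x'.
transitivity (\sw_(x2, z <- x') counit z *: (b x2 * a x1 : k^o)).
  rewrite (@sw_counitr k H k^o (fun y => b y * a x1) x'); last by lin.
  exact: mulrC.
apply: (@eq_sw k H k^o) => x2 z; rewrite [X in a (_ * X)]antipodel.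
rewrite -scalerAr mulr1.
have -> : a (counit z *: x1) = counit z * a x1 :> k by apply: (@linear_scale k H k^o a); lin.
exact: (@mulrCA k).

Qed.

Lemma dual_braided_commutative : is_braided_commutative (dual_mca H).
Proof.
split; [exact: dual_algebraP | exact: dual_act_linearl | exact: dual_act_linearr
  | | | | exact: dual_act_mul | exact: dual_coact_linear | exact: dual_coactA
  | exact: dual_coact_counit | exact: dual_coact_unit | exact: dual_coact_mul
  | exact: dual_drinfeld_yetter | exact: dual_braided_comm].
- by move=> a; apply/lfunP => x; rewrite dual_actE mul1r.
- by move=> a h g; apply/lfunP => x; rewrite !dual_actE mulrA.
- by move=> h; apply/lfunP => x; rewrite dual_actE scale_lfunE !dual_oneE counitM.
Qed.
End DualModule.

(** * Identities for a coquasitriangular structure *)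
Section Coquasi.
Variables (k : fieldType) (H : hopfAlgebra k) (R : coquasitriangular H).
Implicit Types (h g f a b x y : H).

(** The form R(1 ⊗ -) is idempotent and invertible for convolution, so it is the
    counit. *)
Lemma form_1l g : R 1 g = counit g.
Proof.
have [R' invR] := rform_inv R.
have idem x : R 1 x = \sw_(x1, x2 <- x) (R 1 x1 * R 1 x2 : k^o).
  by rewrite -{1}[1]mulr1 rform_mull.
have inv x : \sw_(x1, x2 <- x) (R' 1 x1 * R 1 x2 : k^o) = counit x :> k^o.
  have [_] := invR 1 x; rewrite counit1 mul1r => <-.
  by rewrite sw_1; [| by lin | by lin].
transitivity (\sw_(g1, g2 <- g) counit g1 *: (R 1 g2 : k^o)).
  by rewrite (@sw_counitl k H k^o (fun y => R 1 y)) //; lin.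
rewrite -inv; transitivity (\sw_(g1, g' <- g) \sw_(g2, g3 <- g')
   (R' 1 g1 * (R 1 g2 * R 1 g3) : k^o)).
  transitivity (\sw_(g', g3 <- g)
      (\sw_(g1, g2 <- g') (R' 1 g1 * R 1 g2 : k^o)) *: (R 1 g3 : k^o)).
    by apply: (@eq_sw k H k^o) => g' g3; rewrite inv.
  by sw_auto [:: g].
apply: (@eq_sw k H k^o) => g1 g'; rewrite (idem g').
have lx : linear (fun c : k^o => R' 1 g1 * c : k^o) by lin.
by rewrite (sw_lin _ _ lx).
Qed.

Lemma form_1r h : R h 1 = counit h.
Proof.
have [R' invR] := rform_inv R.
have idem x : R x 1 = \sw_(x1, x2 <- x) (R x1 1 * R x2 1 : k^o).
  by rewrite -{1}[1]mulr1 rform_mulr.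
have inv x : \sw_(x1, x2 <- x) (R' x1 1 * R x2 1 : k^o) = counit x :> k^o.
  have [_] := invR x 1; rewrite counit1 mulr1 => <-.
  by apply: (@eq_sw k H k^o) => *; rewrite sw_1; [| by lin | by lin].
transitivity (\sw_(g1, g2 <- h) counit g1 *: (R g2 1 : k^o)).
  by rewrite (@sw_counitl k H k^o (fun y => R y 1)) //; lin.
rewrite -inv; transitivity (\sw_(g1, g' <- h) \sw_(g2, g3 <- g')
   (R' g1 1 * (R g2 1 * R g3 1) : k^o)).
  transitivity (\sw_(g', g3 <- h)
      (\sw_(g1, g2 <- g') (R' g1 1 * R g2 1 : k^o)) *: (R g3 1 : k^o)).
    by apply: (@eq_sw k H k^o) => g' g3; rewrite inv.
  by sw_auto [:: h].
apply: (@eq_sw k H k^o) => g1 g'; rewrite (idem g').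
have lx : linear (fun c : k^o => R' g1 1 * c : k^o) by lin.
by rewrite (sw_lin _ _ lx).
Qed.

Lemma antipode_scale c h : antipode (c *: h) = c *: antipode h.
Proof. exact: linearZ. Qed.

Lemma form_scalel c h g : R (c *: h) g = c * R h g.
Proof. exact: (linearZl_LR R). Qed.

Lemma form_scaler c h g : R h (c *: g) = c * R h g.
Proof. exact: (linearZr_LR R). Qed.

End Coquasi.

Ltac sw_expand_body ::=
  rewrite -?scalerAl -?scalerAr ?antipode_scale ?antipodeM ?form_scalel
    ?form_scaler ?rform_mulr ?rform_mull.

Section Relations.
Variables (k : fieldType) (H : hopfAlgebra k) (R : coquasitriangular H).
Implicit Types (h g f a b x y : H).

(** The form R(- ⊗ f), applied to the exchange relation between h and g. *)
Lemma yang_baxter h g f :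
  \sw_(h1, h2 <- h) \sw_(g1, g2 <- g) \sw_(f1, f2 <- f)
    (R h1 g1 * R h2 f1 * R g2 f2 : k^o) =
  \sw_(h1, h2 <- h) \sw_(g1, g2 <- g) \sw_(f1, f2 <- f)
    (R g1 f1 * R h1 f2 * R h2 g2 : k^o).
Proof.
transitivity (R (\sw_(h1, h2 <- h) \sw_(g1, g2 <- g) R h1 g1 *: (h2 * g2)) f).
  by sw_auto [:: h; g; f].
by rewrite -rform_comm; sw_auto [:: h; g; f].
Qed.

(** The form R(h ⊗ S(-)), applied to the exchange relation between g and f. *)
Lemma yang_baxter_antipode h g f :
  \sw_(h1, h2 <- h) \sw_(g1, g2 <- g) \sw_(f1, f2 <- f)
    (R h1 (antipode f1) * R h2 (antipode g1) * R g2 f2 : k^o) =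
  \sw_(h1, h2 <- h) \sw_(g1, g2 <- g) \sw_(f1, f2 <- f)
    (R g1 f1 * R h1 (antipode g2) * R h2 (antipode f2) : k^o).
Proof.
transitivity (R h (antipode (\sw_(g1, g2 <- g) \sw_(f1, f2 <- f) R g2 f2 *: (f1 * g1)))).
  by sw_auto [:: h; g; f].
by rewrite rform_comm; sw_auto [:: h; g; f].
Qed.

(** The exchange relation multiplied by S(b_(1)) on the left and by S(b_(4)) on
    the right. *)
Lemma form_comm_antipode x b :
  \sw_(x1, x2 <- x) \sw_(b1, b2 <- b) R x1 b2 *: (antipode b1 * x2) =
  \sw_(x1, x2 <- x) \sw_(b1, b2 <- b) R x2 b1 *: (x1 * antipode b2).
Proof.
transitivity (\sw_(b1, b' <- b) \sw_(q, r <- b') antipode b1 *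
    (\sw_(x1, x2 <- x) \sw_(q1, q2 <- q) R x1 q1 *: (x2 * q2)) * antipode r).
  transitivity (\sw_(b', z <- b) \sw_(x1, x2 <- x) \sw_(b1, b2 <- b') R x1 b2 *:
     (antipode b1 * x2 * (\sw_(q, r <- z) q * antipode r))); last first.
    by sw_auto [:: x; b].
  rewrite (sw_absorbr b (T := fun z => \sw_(q, r <- z) q * antipode r)
    (F := fun b' t => \sw_(x1, x2 <- x) \sw_(b1, b2 <- b') R x1 b2 *: (antipode b1 * x2 * t))).
  - by apply: eq_sw => x1 x2; apply: eq_sw => b1 b2; rewrite mulr1.
  - exact: antipoder.
  - by lin.
  - by lin.
under eq_sw => b1 b' do under eq_sw => q r do rewrite -rform_comm.
transitivity (\sw_(z, b' <- b) \sw_(x1, x2 <- x) \sw_(b1, b2 <- b') R x2 b1 *: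
     ((\sw_(q, r <- z) antipode q * r) * (x1 * antipode b2))).
  by sw_auto [:: x; b].
rewrite (sw_absorbl b (T := fun z => \sw_(q, r <- z) antipode q * r)
    (F := fun t b' => \sw_(x1, x2 <- x) \sw_(b1, b2 <- b') R x2 b1 *: (t * (x1 * antipode b2)))).
- by apply: eq_sw => x1 x2; apply: eq_sw => b1 b2; rewrite mul1r.
- exact: antipodel.
- by lin.
- by lin.
Qed.

Lemma form_antipode_inv h g :
  \sw_(h1, h2 <- h) \sw_(g1, g2 <- g) (R h1 g2 * R h2 (antipode g1) : k^o) =
  counit h * counit g.
Proof.
transitivity (R h (\sw_(g1, g2 <- g) antipode g1 * g2)); first by sw_auto [:: h; g].
by rewrite [sweedler2 g _]antipodel form_scaler form_1r mulrC.
Qed.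

Lemma form_inv_antipode h g :
  \sw_(h1, h2 <- h) \sw_(g1, g2 <- g) (R h1 (antipode g2) * R h2 g1 : k^o) =
  counit h * counit g.
Proof.
transitivity (R h (\sw_(g1, g2 <- g) g1 * antipode g2)); first by sw_auto [:: h; g].
by rewrite [sweedler2 g _]antipoder form_scaler form_1r mulrC.
Qed.
End Relations.

(** * The transmutation of H as a braided-commutative algebra *)
Ltac unfold_transmuted :=
  cbn [mca_coact mca_act mca_alg alg_mul alg_one transmuted transmuted_algebra alg_space];
  rewrite /sweedler3.

Section Transmuted.
Variables (k : fieldType) (H : hopfAlgebra k) (R : coquasitriangular H).
Implicit Types (h g f a b x y : H).

Local Notation "h • g" := (@alg_mul k (transmuted_algebra R) h g)
  (at level 40, left associativity).
Local Notation "h ◁ g" := (@mca_act k H (transmuted R) h g)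
  (at level 40, left associativity).

Lemma transmuted_mul_linearl g : linear (fun h => h • g).
Proof. by unfold_transmuted; lin. Qed.

Lemma transmuted_mul_linearr h : linear (fun g => h • g).
Proof. by unfold_transmuted; lin. Qed.

(** Both sides are linear combinations of h_(3) g_(4) f_(5).  Their coefficients
    differ by a Yang-Baxter equation for the factors without antipodes, followed
    by one with antipodes that involves the factor R(g ⊗ f) which the first
    equation brings next to them. *)
Lemma transmuted_mulA h g f : h • (g • f) = (h • g) • f.
Proof.
symmetry.
transitivity (\sw_(p, h' <- h) \sw_(h3, u <- h') \sw_(h4, h5 <- u)
  \sw_(g1, g' <- g) \sw_(q, z <- g') \sw_(g4, g5 <- z)
  \sw_(f1, f' <- f) \sw_(f2, w <- f') \sw_(r, f5 <- w)
   ((\sw_(p1, p2 <- p) \sw_(q1, q2 <- q) \sw_(r1, r2 <- r)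
      (R p1 q1 * R p2 r1 * R q2 r2 : k^o) : k)
     * (R h4 (antipode f2) * R h5 (antipode g1) * R g5 (antipode f1))) *: (h3 * g4 * f5)).
  by unfold_transmuted; sw_auto [:: h; g; f].
transitivity (\sw_(h1, h' <- h) \sw_(h2, h'' <- h') \sw_(h3, p <- h'')
  \sw_(q, g' <- g) \sw_(g3, z <- g') \sw_(g4, g5 <- z)
  \sw_(f1, f' <- f) \sw_(r, f'' <- f') \sw_(f4, f5 <- f'')
   ((\sw_(p1, p2 <- p) \sw_(q1, q2 <- q) \sw_(r1, r2 <- r)
      (R p1 (antipode r1) * R p2 (antipode q1) * R q2 r2 : k^o) : k)
     * (R h1 f4 * R h2 g3 * R g5 (antipode f1))) *: (h3 * g4 * f5)).
  by under_sw ltac:(rewrite yang_baxter); sw_auto [:: h; g; f].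
under_sw ltac:(rewrite yang_baxter_antipode).
by unfold_transmuted; sw_auto [:: h; g; f].
Qed.

Lemma transmuted_mul1l h : 1 • h = h.
Proof.
transitivity (\sw_(h1, h' <- h) counit h1 *: \sw_(h2, h3 <- h') counit h2 *: h3).
  unfold_transmuted; sw_auto [:: h].
  by rewrite !form_1l counit_antipode mul1r scalerA.
rewrite (sw_counitl h (F := fun y => \sw_(h2, h3 <- y) counit h2 *: h3)); last by lin.
exact: counitl.
Qed.

Lemma transmuted_mul1r h : h • 1 = h.
Proof.
transitivity (\sw_(h1, h' <- h) counit h1 *: \sw_(h2, h3 <- h') counit h3 *: h2).
  unfold_transmuted; sw_auto [:: h].
  by rewrite antipode1 !form_1r mulr1 scalerA mulrC.
rewrite (sw_counitl h (F := fun y => \sw_(h2, h3 <- y) counit h3 *: h2)); last by lin.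
exact: counitr.
Qed.

Lemma transmuted_act_linearl h : linear (fun b => b ◁ h).
Proof. by unfold_transmuted; lin. Qed.

Lemma transmuted_act_linearr b : linear (fun h => b ◁ h).
Proof. by unfold_transmuted; lin. Qed.

Lemma transmuted_coact_linear : linear (@mca_coact k H (transmuted R)).
Proof. by unfold_transmuted; lin. Qed.

Lemma transmuted_act1 b : b ◁ 1 = b.
Proof.
transitivity (\sw_(h1, h' <- b) counit h1 *: \sw_(h2, h3 <- h') counit h3 *: h2).
  by unfold_transmuted; sw_auto [:: b]; rewrite form_1l form_1r scalerA.
rewrite (sw_counitl b (F := fun y => \sw_(h2, h3 <- y) counit h3 *: h2)); last by lin.
exact: counitr.
Qed.

Lemma transmuted_actM b h g : (b ◁ h) ◁ g = b ◁ (h * g).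
Proof. by unfold_transmuted; sw_auto [:: b; h; g]. Qed.

Lemma transmuted_act_unit h : 1 ◁ h = counit h *: 1.
Proof.
transitivity (\sw_(h1, h2 <- h) counit h1 *: (counit h2 *: (1 : H))).
  by unfold_transmuted; sw_auto [:: h]; rewrite form_1l form_1r scalerA.
by rewrite (sw_counitl h (F := fun y => counit y *: (1 : H))) //; lin.
Qed.

(** The Yang-Baxter equation rearranges the factors that use pieces to the left of
    a_(3) and b_(4); the form R(a ⊗ -), applied to [form_comm_antipode], then
    moves the factor with the antipode of b_(1) past the action. *)
Lemma transmuted_act_mul a b x : (a • b) ◁ x = \sw_(x1, x2 <- x) (a ◁ x1) • (b ◁ x2).
Proof.
transitivity (\sw_(p, a' <- a) \sw_(a3, a'' <- a') \sw_(a4, a5 <- a'')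
  \sw_(b1, b' <- b) \sw_(q, b'' <- b') \sw_(b4, b5 <- b'')
  \sw_(r, x' <- x) \sw_(x3, x4 <- x')
  ((\sw_(r1, r2 <- r) \sw_(p1, p2 <- p) \sw_(q1, q2 <- q)
      (R p1 q1 * R r1 q2 * R r2 p2 : k^o) : k)
    * (R a4 x3 * R a5 (antipode b1) * R b5 x4)) *: (a3 * b4)).
  by unfold_transmuted; sw_auto [:: a; b; x].
under_sw ltac:(rewrite -yang_baxter).
transitivity (\sw_(x1, x' <- x) \sw_(r, x4 <- x')
  \sw_(a1, a' <- a) \sw_(a2, a'' <- a') \sw_(a3, p <- a'')
  \sw_(q, b' <- b) \sw_(b3, b'' <- b') \sw_(b4, b5 <- b'')
  (R x1 a1 * R a2 b3 * R p (\sw_(r1, r2 <- r) \sw_(q1, q2 <- q)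
     R r1 q2 *: (antipode q1 * r2)) * R b5 x4) *: (a3 * b4)).
  by sw_auto [:: x; a; b].
under_sw ltac:(rewrite form_comm_antipode).
by unfold_transmuted; sw_auto [:: x; a; b].
Qed.

Lemma transmuted_coact_unit : @mca_coact k H (transmuted R) 1 = (1 : H) ⊗ (1 : H).
Proof.
unfold_transmuted; rewrite sw_1; [| by lin | by lin].
by rewrite sw_1 ?antipode1 ?mulr1; [| by lin | by lin].
Qed.

Lemma transmuted_coactE (W : vectType k) b (F : H -> H -> W) :
    (forall y, linear (F^~ y)) -> (forall x, linear (F x)) ->
  \tsum_(b0, b1 <- @mca_coact k H (transmuted R) b) F b0 b1 =
  \sw_(b1, b2, b3 <- b) F b2 (antipode b1 * b3).
Proof.
move=> l1 l2; unfold_transmuted; rewrite (tsum_lin _ _ (tsum_linear F)).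
apply: eq_sw => b1 b'; rewrite (tsum_lin _ _ (tsum_linear F)).
by apply: eq_sw => b2 b3; rewrite tsumE.
Qed.

Lemma transmuted_algebraP : is_algebra (transmuted_algebra R).
Proof.
split; [exact: transmuted_mul_linearl | exact: transmuted_mul_linearr
  | exact: transmuted_mulA | exact: transmuted_mul1l | exact: transmuted_mul1r].
Qed.
End Transmuted.

Section TransmutedCoaction.
Variables (k : fieldType) (H : hopfAlgebra k) (R : coquasitriangular H).
Implicit Types (h g f a b x y : H).

Local Notation "h • g" := (@alg_mul k (transmuted_algebra R) h g)
  (at level 40, left associativity).
Local Notation "h ◁ g" := (@mca_act k H (transmuted R) h g)
  (at level 40, left associativity).

Ltac lin_hook ::= first
  [ apply: linear_algl; [by eauto using mca_algebra, transmuted_algebraP | lin]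
  | apply: linear_algr; [by eauto using mca_algebra, transmuted_algebraP | lin]
  | apply: (linear_comp (transmuted_coact_linear _)); lin
  | apply: (linear_comp (transmuted_act_linearl _ _)); lin
  | apply: (linear_comp (transmuted_act_linearr _ _)); lin ].

Local Notation coact := (@mca_coact k H (transmuted R)).

Lemma transmuted_coactA b :
  \tsum_(b0, b1 <- coact b) \tsum_(b00, b01 <- coact b0) b00 ⊗ b01 ⊗ b1 =
  \tsum_(b0, b1 <- coact b) b0 ⊗ comul b1.
Proof.
transitivity (\sw_(b1, b2, b3 <- b) \sw_(x1, x2, x3 <- b2)
    x2 ⊗ (antipode x1 * x3) ⊗ (antipode b1 * b3)).
  rewrite transmuted_coactE; [| by lin | by lin].
  apply: eq_sw => b1 b'; apply: eq_sw => b2 b3.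
  by rewrite transmuted_coactE; [| by lin | by lin].
rewrite transmuted_coactE; [| by lin | by lin].
transitivity (\sw_(b1, b2, b3 <- b) b2 ⊗ (\sw_(x, y <- antipode b1 * b3) x ⊗ y)).
  by sw_auto [:: b].
by apply: eq_sw => b1 b'; apply: eq_sw => b2 b3; rewrite [X in _ ⊗ X]tsum_tens.
Qed.

Lemma transmuted_coact_counit b : \tsum_(b0, b1 <- coact b) counit b1 *: b0 = b.
Proof.
rewrite transmuted_coactE; [| by lin | by lin].
transitivity (\sw_(b1, b' <- b) counit b1 *: \sw_(b2, b3 <- b') counit b3 *: b2).
  apply: eq_sw => b1 b'; rewrite -sw_scale; apply: eq_sw => b2 b3.
  by rewrite counitM counit_antipode scalerA.
rewrite (sw_counitl b (F := fun y => \sw_(b2, b3 <- y) counit b3 *: b2)); last by lin.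
exact: counitr.
Qed.

(** The exchange relation is used twice: under the antipode, between the left
    pieces of a and b, and for S(b_(1)) in the place of one argument, between
    the right pieces of a and the left pieces of b. *)
Lemma transmuted_coact_mul a b : coact (a • b) =
  \tsum_(a0, a1 <- coact a) \tsum_(b0, b1 <- coact b) (a0 • b0) ⊗ (a1 * b1).
Proof.
transitivity (\sw_(p, a' <- a) \sw_(a3, a'' <- a') \sw_(a4, a5 <- a'')
  \sw_(b1, b' <- b) \sw_(r, b'' <- b') \sw_(b4, b5 <- b'')
  R a5 (antipode b1) *: ((a3 * b4) ⊗ (antipode (\sw_(p1, p2 <- p)
     \sw_(r1, r2 <- r) R p1 r1 *: (p2 * r2)) * (a4 * b5)))).
  by unfold_transmuted; sw_auto [:: a; b].
under_sw ltac:(rewrite -rform_comm).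
transitivity (\sw_(a1, a' <- a) \sw_(a2, a'' <- a') \sw_(a3, u <- a'')
  \sw_(v, b' <- b) \sw_(b3, b'' <- b') \sw_(b4, b5 <- b'')
  R a2 b3 *: ((a3 * b4) ⊗ (antipode a1 * (\sw_(u1, u2 <- u)
     \sw_(g1, g2 <- antipode v) R u2 g2 *: (g1 * u1)) * b5))).
  by sw_auto [:: a; b].
under_sw ltac:(rewrite rform_comm).
rewrite transmuted_coactE; [| by lin | by lin].
transitivity (\sw_(a1, a2, a3 <- a) \sw_(b1, b2, b3 <- b)
   (a2 • b2) ⊗ (antipode a1 * a3 * (antipode b1 * b3))).
  by unfold_transmuted; sw_auto [:: a; b].
apply: eq_sw => a1 a'; apply: eq_sw => a2 a3.
by rewrite transmuted_coactE; [| by lin | by lin].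
Qed.

Lemma transmuted_drinfeld_yetter b h :
  \sw_(h1, h2 <- h) \tsum_(c0, c1 <- coact (b ◁ h2)) c0 ⊗ (h1 * c1) =
  \tsum_(b0, b1 <- coact b) \sw_(h1, h2 <- h) (b0 ◁ h1) ⊗ (b1 * h2).
Proof.
transitivity (\sw_(x, h3 <- h) \sw_(y, b' <- b) \sw_(b3, b'' <- b')
   \sw_(b4, b5 <- b'') R b5 h3 *: (b3 ⊗ ((\sw_(x1, x2 <- x)
      \sw_(y1, y2 <- y) R x2 y1 *: (x1 * antipode y2)) * b4))).
  transitivity (\sw_(h1, h2 <- h) \sw_(c1, c2, c3 <- b ◁ h2)
      c2 ⊗ (h1 * (antipode c1 * c3))).
    by apply: eq_sw => h1 h2; rewrite transmuted_coactE; [| by lin | by lin].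
  by unfold_transmuted; sw_auto [:: h; b].
under_sw ltac:(rewrite -form_comm_antipode).
transitivity (\sw_(h1, x <- h) \sw_(b1, b' <- b) \sw_(b2, b'' <- b')
   \sw_(b3, y <- b'') R h1 b2 *: (b3 ⊗ (antipode b1 * (\sw_(y1, y2 <- y)
      \sw_(x1, x2 <- x) R y2 x2 *: (x1 * y1))))).
  by sw_auto [:: h; b].
under_sw ltac:(rewrite rform_comm).
rewrite transmuted_coactE; [| by lin | by lin].
by unfold_transmuted; sw_auto [:: h; b].
Qed.

(** On either side one factor R(- ⊗ S -) of the product cancels against a factor
    of the action; the two results differ by the exchange relation. *)
Lemma transmuted_reflection a b :
  \sw_(b1, b2 <- b) (a ◁ b1) • b2 = \sw_(b1, b2 <- b) b1 • (a ◁ b2).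
Proof.
transitivity (\sw_(b1, b' <- b) \sw_(a1, a' <- a) \sw_(a2, a3 <- a')
   \sw_(b2, b3 <- b') (R b1 a1 * R a2 b2) *: (a3 * b3)).
  transitivity (\sw_(b1, b' <- b) \sw_(z, y <- a) \sw_(u, v <- b')
     (\sw_(p1, p2 <- y) \sw_(q1, q2 <- u) (R p1 (antipode q2) * R p2 q1 : k^o) : k)
       *: \sw_(a1, a' <- z) \sw_(a2, a3 <- a') \sw_(v1, v2 <- v)
             (R b1 a1 * R a2 v1) *: (a3 * v2)).
    by unfold_transmuted; sw_auto [:: a; b].
  apply: eq_sw => b1 b'; apply: (sw_counit_rl a b'
     (F := fun z v => \sw_(a1, a' <- z) \sw_(a2, a3 <- a') \sw_(v1, v2 <- v)
             (R b1 a1 * R a2 v1) *: (a3 * v2))); [|by lin|by lin].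
  exact: form_inv_antipode.
transitivity (\sw_(b1, y <- b) \sw_(a1, x <- a) R b1 a1 *: (\sw_(x1, x2 <- x)
   \sw_(y1, y2 <- y) R x1 y1 *: (x2 * y2))).
  by sw_auto [:: a; b].
under_sw ltac:(rewrite -rform_comm).
transitivity (\sw_(b1, b' <- b) \sw_(b2, b'' <- b') \sw_(v1, v' <- a)
   \sw_(v2, v3 <- v') (R b1 v1 * R v3 b'') *: (b2 * v2)).
  by sw_auto [:: a; b].
transitivity (\sw_(b1, b' <- b) \sw_(b2, b'' <- b') \sw_(y, z <- b'') \sw_(u, v <- a)
   (\sw_(p1, p2 <- y) \sw_(q1, q2 <- u) (R p1 (antipode q2) * R p2 q1 : k^o) : k)
     *: \sw_(v1, v' <- v) \sw_(v2, v3 <- v') (R b1 v1 * R v3 z) *: (b2 * v2)).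
  apply: eq_sw => b1 b'; apply: eq_sw => b2 b''; symmetry.
  apply: (sw_counit_ll b'' a (F := fun z v => \sw_(v1, v' <- v) \sw_(v2, v3 <- v')
     (R b1 v1 * R v3 z) *: (b2 * v2))); [|by lin|by lin].
  exact: form_inv_antipode.
by unfold_transmuted; sw_auto [:: a; b].
Qed.

(** The right-hand side is b_(2) (a ◁ S(b_(1)) b_(3)).  The action by S(b_(1)) comes
    first, so the reflection equation for a ◁ S(b_(1)) turns this into
    (a ◁ S(b_(1)) b_(2)) b_(3). *)
Lemma transmuted_braided_comm a b :
  a • b = \tsum_(b0, b1 <- coact b) b0 • (a ◁ b1).
Proof.
rewrite transmuted_coactE; [| by lin | by lin].
transitivity (\sw_(b1, b' <- b) \sw_(b2, b3 <- b') b2 • ((a ◁ antipode b1) ◁ b3)).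
  rewrite [RHS](_ : _ =
      \sw_(b1, b' <- b) \sw_(b2, b3 <- b') ((a ◁ antipode b1) ◁ b2) • b3); last first.
    by apply: eq_sw => b1 b'; rewrite transmuted_reflection.
  transitivity (\sw_(y, z <- b) (a ◁ (\sw_(b1, b2 <- y) antipode b1 * b2)) • z).
    rewrite (sw_absorbl b (T := fun y => \sw_(b1, b2 <- y) antipode b1 * b2)
      (F := fun t z => (a ◁ t) • z)); [| exact: antipodel | by lin | by lin].
    by rewrite transmuted_act1.
  transitivity (\sw_(y, z <- b) \sw_(b1, b2 <- y) (a ◁ (antipode b1 * b2)) • z).
    apply: eq_sw => y z.
    have lx : linear (fun t => (a ◁ t) • z) by lin.
    exact: sw_lin lx.
  rewrite sw_coassoc; [| by lin | by lin | by lin].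
  by apply: eq_sw => b1 b'; apply: eq_sw => b2 b3; rewrite transmuted_actM.
by apply: eq_sw => b1 b'; apply: eq_sw => b2 b3; rewrite transmuted_actM.
Qed.

Lemma transmuted_braided_commutative : is_braided_commutative (transmuted R).
Proof.
split; [exact: transmuted_algebraP | exact: transmuted_act_linearl
  | exact: transmuted_act_linearr | exact: transmuted_act1 | exact: transmuted_actM
  | exact: transmuted_act_unit | exact: transmuted_act_mul
  | exact: transmuted_coact_linear | exact: transmuted_coactA
  | exact: transmuted_coact_counit | exact: transmuted_coact_unit
  | exact: transmuted_coact_mul | exact: transmuted_drinfeld_yetter
  | exact: transmuted_braided_comm].
Qed.
End TransmutedCoaction.

(** * Morphisms of action bialgebroids *)
Section ActionAlgebroidMorphism.
Variables (k : fieldType) (H : hopfAlgebra k).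
Variables (B B' : moduleComoduleAlgebraData H) (f : B -> B').
Hypotheses (bcB : is_braided_commutative B) (bcB' : is_braided_commutative B').
Hypothesis f_alg : algebra_map f.
Hypothesis f_act : forall a h, f (mca_act a h) = mca_act (f a) h.
Hypothesis f_coact : forall a, tmap f id (mca_coact a) = mca_coact (f a).

Local Notation F := (tmap f (fun h : H => h)).
Local Notation L := (smash_opp B).
Local Notation L' := (smash_opp B').

Let lf : linear f := algebra_map_linear f_alg.

Lemma tmap_idE (a : B) (h : H) : F (a ⊗ h) = f a ⊗ h.
Proof.
rewrite /tmap tsumE //.
- by move=> b; apply: linear_tensl.
- by move=> b; exact: tens_linearr.
Qed.

Lemma action_algebroid_morphism :
  bialgebroid_morphism (L := action_algebroid B) (L' := action_algebroid B') F f.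
Proof.
have lF : linear F by exact: tsum_linear.
have lFL : linear (F : L -> L') by exact: tsum_linear.
split=> //.
- split=> //.
    by rewrite /= tmap_idE (algebra_map1 f_alg).
  move=> X Y; move: X; apply: (tensor_ext (U := B) (V := H) (W := tensor B' H)).
  + by move=> c u v; rewrite smash_linearl; exact: lF.
  + by move=> c u v; rewrite lF; exact: smash_linearl.
  move=> a h; move: Y; apply: (tensor_ext (U := B) (V := H) (W := tensor B' H)).
  + by move=> c u v; rewrite smash_linearr; exact: lF.
  + by move=> c u v; rewrite lF; exact: smash_linearr.
  move=> b g; rewrite !tmap_idE !smashE //.
  rewrite (sw_lin _ _ lFL); apply: eq_sw => h1 h2.
  by rewrite tmap_idE (algebra_mapM f_alg) f_act.
- by move=> b; rewrite /= tmap_idE.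
- move=> X; apply: eq_over_base_refl; move: X.
  apply: (tensor_ext (U := B) (V := H)).
  + by apply: linear_comp; [exact: tsum_linear | exact: action_comul_linear].
  + by apply: linear_comp lF; exact: action_comul_linear.
  move=> a h; rewrite tmap_idE !action_comulE //.
  have lT : linear (tmap (F : L -> L') (F : L -> L')) by exact: tsum_linear.
  rewrite (sw_lin _ _ lT); apply: eq_sw => h1 h2.
  rewrite /tmap tsumE ?tmap_idE.
  + by rewrite -/(tmap _ _ _) -/(tmap _ _ _) !tmap_idE (algebra_map1 f_alg).
  + by move=> y; apply: linear_tensl; exact: tsum_linear.
  + by move=> y; apply: linear_tensr; exact: tsum_linear.
- apply: (tensor_ext (U := B) (V := H)).
  + by apply: linear_comp lF; exact: action_counit_linear.
  + by apply: linear_comp lf _; exact: action_counit_linear.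
  by move=> a h; rewrite tmap_idE !action_counitE // linear_scale.
Qed.

Lemma action_algebroid_isomorphism : bijective f ->
  bialgebroid_isomorphism (L := action_algebroid B) (L' := action_algebroid B') F f.
Proof.
move=> bij_f; split=> //; first exact: action_algebroid_morphism.
have [g fK gK] := bij_f.
have lg : linear g.
  by move=> c u v; apply: (bij_inj bij_f); rewrite lf !gK.
have lF : linear F by exact: tsum_linear.
pose G : tensor B' H -> tensor B H := tmap g (fun h : H => h).
have GE a h : G (a ⊗ h) = g a ⊗ h.
  rewrite /G /tmap tsumE //.
  - by move=> b; apply: linear_tensl.
  - by move=> b; exact: tens_linearr.
have lG : linear G by exact: tsum_linear.
exists G.
- apply: (tensor_ext (U := B) (V := H) (linear_comp lG lF) (@linear_id _ _)).
  by move=> a h; rewrite tmap_idE GE fK.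
- apply: (tensor_ext (U := B') (V := H) (linear_comp lF lG) (@linear_id _ _)).
  by move=> a h; rewrite GE tmap_idE gK.
Qed.
End ActionAlgebroidMorphism.

(** * The quantum Killing form *)
Section KillingForm.
Variables (k : fieldType) (H : hopfAlgebra k) (R : coquasitriangular H).
Implicit Types (h g a b x y : H).
Local Notation Q := (killing_form R).
Local Notation "h • g" := (@alg_mul k (transmuted_algebra R) h g)
  (at level 40, left associativity).
Local Notation "h ◁ g" := (@mca_act k H (transmuted R) h g)
  (at level 40, left associativity).
Local Notation coact := (@mca_coact k H (transmuted R)).

Lemma killing_formE h x : Q h x =
  \sw_(x1, x2 <- x) \sw_(h1, h2 <- h) (R x1 h1 * R h2 x2 : k^o).
Proof. exact: sweedler_formE. Qed.

Lemma killing_form_linear : linear Q.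
Proof.
move=> c u v; apply/lfunP => x; rewrite add_lfunE scale_lfunE !killing_formE.
have lx : linear (fun h => \sw_(x1, x2 <- x) \sw_(h1, h2 <- h) (R x1 h1 * R h2 x2 : k^o)).
  by lin.
exact: lx.
Qed.

Lemma killing_form1 : Q 1 = dual_one H.
Proof.
apply/lfunP => x; rewrite killing_formE dual_oneE.
rewrite -[RHS](@sw_counitl k H k^o (fun y => counit y) x); last by lin.
by sw_auto [:: x]; rewrite form_1l form_1r.
Qed.

(** After a Yang-Baxter equation and [form_comm_antipode], the two forms R that
    the transmuted product contributes stand next to each other and cancel. *)
Lemma killing_formM a b : Q (a • b) = dual_mul (Q a) (Q b).
Proof.
apply/lfunP => x; rewrite killing_formE dual_mulE.
transitivity (\sw_(p, a' <- a) \sw_(a3, a4 <- a') \sw_(b1, b' <- b)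
   \sw_(q, b4 <- b') \sw_(r, x' <- x) \sw_(x3, x4 <- x')
   ((\sw_(r1, r2 <- r) \sw_(p1, p2 <- p) \sw_(q1, q2 <- q)
       (R p1 q1 * R r1 q2 * R r2 p2 : k^o) : k)
     * (R a3 x3 * R b4 x4 * R a4 (antipode b1)) : k^o)).
  by unfold_transmuted; sw_auto [:: x; a; b].
under_sw ltac:(rewrite -yang_baxter).
transitivity (\sw_(a1, a' <- a) \sw_(a2, p <- a') \sw_(q, b' <- b)
   \sw_(b3, b4 <- b') \sw_(x1, x' <- x) \sw_(r, x4 <- x')
   (R x1 a1 * R a2 b3 * R b4 x4 * R p (\sw_(r1, r2 <- r) \sw_(q1, q2 <- q)
       R r1 q2 *: (antipode q1 * r2)) : k^o)).
  by sw_auto [:: x; a; b].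
under_sw ltac:(rewrite form_comm_antipode).
transitivity (\sw_(a1, a' <- a) \sw_(b1, b' <- b) \sw_(y, z <- a') \sw_(u, v <- b')
   (\sw_(p1, p2 <- y) \sw_(q1, q2 <- u) (R p1 q2 * R p2 (antipode q1) : k^o) : k)
   *: (\sw_(x1, x' <- x) \sw_(x2, x'' <- x') \sw_(x3, x4 <- x'')
         (R x1 a1 * R x3 b1 * R z x2 * R v x4 : k^o))).
  by sw_auto [:: x; a; b].
transitivity (\sw_(a1, z <- a) \sw_(b1, v <- b) \sw_(x1, x' <- x)
   \sw_(x2, x'' <- x') \sw_(x3, x4 <- x'') (R x1 a1 * R x3 b1 * R z x2 * R v x4 : k^o)).
  apply: (@eq_sw k H k^o) => a1 a'; apply: (@eq_sw k H k^o) => b1 b'.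
  apply: (@sw_counit_ll k H k^o _ (fun z v => \sw_(x1, x' <- x)
     \sw_(x2, x'' <- x') \sw_(x3, x4 <- x'') (R x1 a1 * R x3 b1 * R z x2 * R v x4 : k^o)));
    [| by lin | by lin].
  exact: form_antipode_inv.
transitivity (\sw_(y, z <- x)
   ((\sw_(x1, x2 <- y) \sw_(h1, h2 <- a) (R x1 h1 * R h2 x2 : k^o) : k) *
    (\sw_(x1, x2 <- z) \sw_(h1, h2 <- b) (R x1 h1 * R h2 x2 : k^o) : k) : k^o)).
  by sw_auto [:: x; a; b].
by apply: (@eq_sw k H k^o) => y z; rewrite !killing_formE.
Qed.

Lemma killing_form_act b h : Q (b ◁ h) = dual_act (Q b) h.
Proof.
apply/lfunP => x; rewrite dual_actE !killing_formE.
by unfold_transmuted; sw_auto [:: h; x; b].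
Qed.

(** The product S(b_(1)) b_(2) is inserted in front of x_(1) S(x_(4)); two uses of
    the exchange relation carry the remaining pieces of b through those of x,
    and then x_(3) S(x_(4)) cancels. *)
Lemma killing_form_coact b : tmap Q id (coact b) = dual_coact (Q b).
Proof.
apply: dual_eval_inj => x; rewrite dual_coact_eval.
transitivity (\sw_(b1, b2, b3 <- b) (Q b2 x : k) *: (antipode b1 * b3)).
  have lx := @dual_eval_linear k H H x.
  rewrite /tmap (tsum_lin _ _ lx).
  under eq_tsum => b0 b1 do rewrite dual_eval_tens.
  rewrite transmuted_coactE //; last by lin.
  move=> y; apply: linear_scalel; apply: linear_duall; exact: killing_form_linear.
symmetry.
transitivity (\sw_(x1, x2, x3 <- x) (\sw_(y1, y2 <- x2) \sw_(h1, h2 <- b)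
     (R y1 h1 * R h2 y2 : k^o) : k) *: (x1 * antipode x3)).
  by apply: eq_sw => x1 x'; apply: eq_sw => x2 x3; rewrite killing_formE.
transitivity (\sw_(y, z <- b) \sw_(x1, x' <- x) \sw_(x2, x'' <- x') \sw_(x3, x4 <- x'')
   \sw_(z1, z2 <- z) (R x2 z1 * R z2 x3) *:
      ((\sw_(p, q <- y) antipode p * q) * x1 * antipode x4)).
  rewrite (sw_absorbl b (T := fun y => \sw_(p, q <- y) antipode p * q)
    (F := fun t z => \sw_(x1, x' <- x) \sw_(x2, x'' <- x') \sw_(x3, x4 <- x'')
      \sw_(z1, z2 <- z) (R x2 z1 * R z2 x3) *: (t * x1 * antipode x4)));
    [| exact: antipodel | by lin | by lin].
  by sw_auto [:: x; b]; rewrite mul1r.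
transitivity (\sw_(b1, b' <- b) \sw_(w, b4 <- b') \sw_(r, x' <- x) \sw_(x3, x4 <- x')
   R b4 x3 *: (antipode b1 * (\sw_(r1, r2 <- r) \sw_(w1, w2 <- w)
      R r2 w2 *: (w1 * r1)) * antipode x4)).
  by sw_auto [:: x; b].
under_sw ltac:(rewrite rform_comm).
transitivity (\sw_(b1, b' <- b) \sw_(b2, w <- b') \sw_(x1, x' <- x) \sw_(r, x4 <- x')
   R x1 b2 *: (antipode b1 * (\sw_(w1, w2 <- w) \sw_(r1, r2 <- r)
      R w2 r2 *: (r1 * w1)) * antipode x4)).
  by sw_auto [:: x; b].
under_sw ltac:(rewrite rform_comm).
transitivity (\sw_(y, z <- x) \sw_(b1, b' <- b) \sw_(b2, b'' <- b')
   \sw_(b3, b4 <- b'') \sw_(y1, y2 <- y) (R y1 b2 * R b3 y2) *: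
      (antipode b1 * b4 * (\sw_(p, q <- z) p * antipode q))).
  by sw_auto [:: x; b].
rewrite (sw_absorbr x (T := fun z => \sw_(p, q <- z) p * antipode q)
   (F := fun y t => \sw_(b1, b' <- b) \sw_(b2, b'' <- b') \sw_(b3, b4 <- b'')
      \sw_(y1, y2 <- y) (R y1 b2 * R b3 y2) *: (antipode b1 * b4 * t)));
  [| exact: antipoder | by lin | by lin].
transitivity (\sw_(b1, b2, b3 <- b) (\sw_(y1, y2 <- x) \sw_(h1, h2 <- b2)
     (R y1 h1 * R h2 y2 : k^o) : k) *: (antipode b1 * b3)).
  by sw_auto [:: x; b]; rewrite mulr1.
by apply: eq_sw => b1 b'; apply: eq_sw => b2 b3; rewrite killing_formE.
Qed.

Lemma killing_form_algebra_map :
  algebra_map (A := transmuted_algebra R) (A' := dual_algebra H) Q.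
Proof.
split; [exact: killing_form_linear | exact: killing_form1 | exact: killing_formM].
Qed.
End KillingForm.

Theorem proposition5p15 (k : fieldType) (H : hopfAlgebra k)
    (R : coquasitriangular H) :
  let Q : transmuted R -> dual_mca H := killing_form R in
  let Q_id : btotal (action_algebroid (transmuted R)) -> btotal (weyl_algebroid H) :=
    tmap Q (fun h : H => h) in
  [/\ is_left_bialgebroid (action_algebroid (transmuted R)),
      is_left_bialgebroid (weyl_algebroid H),
      bialgebroid_morphism Q_id Q &
      factorisable R -> bialgebroid_isomorphism Q_id Q].
Proof.
have bcT := transmuted_braided_commutative R.
have bcD := dual_braided_commutative H.
have Qalg := killing_form_algebra_map R.
split.
- exact: action_algebroid_left_bialgebroid.
- exact: action_algebroid_left_bialgebroid.
- exact: (action_algebroid_morphism bcT bcD Qalg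
    (killing_form_act R) (killing_form_coact R)).
- exact: (action_algebroid_isomorphism bcT bcD Qalg
    (killing_form_act R) (killing_form_coact R)).
Qed.
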